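(* Let the coefficients $A=(a_{ij})$, $f_i$, $\beta$, $d_i$, $r_i$ satisfy all the coefficient hypotheses listed in the context, with $D_2=0$ and $H_2=0$. Assume that there exists a function $b:[0,+\infty)\to\mathbb R^+$ such that $\beta(t,x)\ge b(t)$ for all $(t,x)\in[0,+\infty)\times\Omega$ and $\lim_{t\to+\infty}b(t)=+\infty$. Assume that there exists $\bar\mu>0$ such that $a_{ij}(t,x)\ge\bar\mu$ for all $i\ne j$ and all $(t,x)\in[0,+\infty)\times\Omega$. Let $w=(w_1,\dots,w_k)\in\bigcap_{T>0}H^1(\Omega\times(0,T))^k$ be a weak solution, in the sense of $H^{-1}(\Omega\times(0,T))^k$ for all $T>0$, of $$\begin{cases} r_i(x)\partial_t w_i-d_i(t)\Delta w_i=f_i(t,x,w_i)-\beta(t,x)w_i\sum_{j\ne i}a_{ij}(t,x)w_j^2 & \forall i=1,\dots,k,\\ 0\le w_i\le 1 & \forall i=1,\dots,k.\end{cases}$$ If there exists $\bar v=(\bar v_1,\dots,\bar v_k)\in L^1_{loc}(\Omega)^k$ such that $w(t)\to\bar v$ in $L^1_{loc}(\Omega)$ as $t\to+\infty$, then $\bar v$ is a segregated function, that is, $$\bar v_i\bar v_j=0\quad\text{a.e. in }\Omega,\quad\forall i\ne j.$$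
   Context: Setting. $\Omega\subset\mathbb R^N$ is an open, bounded, smooth domain, $k\ge 2$ is a fixed integer, $\mathbb R^+=(0,+\infty)$; $\nabla,\Delta$ act in the space variable $x$ only. For $w\in\bigcap_{T>0}H^1(\Omega\times(0,T))^k$, $w(t)=w(t,\cdot)$ denotes the value at time $t$ of the representative continuous in time with values in $L^2(\Omega)^k$. Coefficient hypotheses. There are measurable functions $U_1,U_2,U_3:\Omega\to\mathbb R^+$ with $U_1U_3\in L^1(\Omega)$, $U_2\in L^1(\Omega)$, such that the following hold (all functions below are measurable in $(t,x)$). (1) $A(t,x)=(a_{ij}(t,x))_{i,j}$ is a symmetric $k\times k$ matrix for $(t,x)\in[0,+\infty)\times\Omega$, with $a_{ii}=0$ and $a_{ij}=a_{ji}\ge 0$ for $i\ne j$; each $a_{ij}$ is continuous and differentiable in $t$; there are $A_1,A_2\ge 0$ with $a_{ij}(t,x),\,|\partial_t a_{ij}(t,x)|\le A_1e^{A_2t}U_1(x)$ for all $(t,x)$ and all $i,j$. (2) $f_i=f_i(t,x,s):[0,+\infty)\times\Omega\times\mathbb R\to\mathbb R$, $i=1,\dots,k$, are continuous in $s$; $f_i(t,x,s)\ge 0$ for $s\le 0$ and $f_i(t,x,s)\le 0$ for $s\ge 1$, for all $(t,x)$; $f_i$ is continuous and differentiable in $t$; there are $H_1,H_2\ge 0$ and an open set $I\supset[0,1]$ with $|f_i(t,x,s)|,\,|\partial_tf_i(t,x,s)|\le H_1e^{H_2t}U_2(x)$ for all $(t,x,s)\in[0,+\infty)\times\Omega\times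 I$ and all $i$. (3) $\beta:[0,+\infty)\times\Omega\to\mathbb R^+$ is continuous and differentiable in $t$, and there are $C_1,C_2>0$ with $\beta(t,x),\,|\partial_t\beta(t,x)|\le C_1e^{C_2t}U_3(x)$ for all $(t,x)$. (4) $d_i:[0,+\infty)\to\mathbb R^+$, $i=1,\dots,k$, are continuous and differentiable; there are $D_1>0$, $D_2\ge 0$, $D_3\ge0$ and a function $\rho:[0,+\infty)\to(0,+\infty)$ with $1/\rho$ locally bounded on $[0,+\infty)$ such that $\rho(t)\le d_i(t)\le D_1e^{D_2t}$ and $|d_i'(t)|\le D_3d_i(t)$ for all $t\ge 0$ and all $i$. (5) $r_i:\Omega\to\mathbb R$, $i=1,\dots,k$, are measurable and there are $R_1,R_2>0$ with $R_1\le r_i(x)\le R_2$ for all $x\in\Omega$ and all $i$. Weak solution. $w\in\bigcap_{T>0}H^1(\Omega\times(0,T))^k$ with $0\le w_i\le 1$ a.e. is a weak solution of the equations in the sense of $H^{-1}(\Omega\times(0,T))^k$ for all $T>0$ if, for every $T>0$, every $i$ and every $\varphi\in H^1_0(\Omega\times(0,T))$, $$\int_0^{T}\int_\Omega r_i\,\partial_tw_i\,\varphi+d_i\nabla w_i\cdot\nabla\varphi-f_i(t,x,w_i)\varphi+\beta w_i\sum_{j\ne i}a_{ij}w_j^2\,\varphi\,dx\,dt=0.$$ Here, since the last two terms involve functions that are only in $L^1(\Omega\times(0,T))$, the identity is required as an integral identity for $\varphi\in C_c^\infty(\Omega\times(0,T))$, and for general $\varphi\in H^1_0$ the pairing with these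 terms is understood as the continuous extension by density (i.e. the equation is an identity of distributions all of whose sides lie in $H^{-1}(\Omega\times(0,T))$). *)

(* Defs.v *)
From HB Require Import structures.
From mathcomp Require Import all_boot all_order all_algebra.
From mathcomp Require Import all_classical all_reals all_analysis measurable_realfun.

Set Implicit Arguments.
Unset Strict Implicit.
Unset Printing Implicit Defensive.
Import Order.TTheory GRing.Theory Num.Theory.
Import numFieldNormedType.Exports.

Local Open Scope classical_set_scope.
Local Open Scope ring_scope.

Section rV_measurable.
Context {R : realType} {n : nat}.

Let coor : 'I_n -> 'rV[R]_n -> R := fun i x => x ord0 i.

Let rV_set0 : g_sigma_preimage coor set0.
Proof. exact: sigma_algebra0. Qed.

Let rV_setC A : g_sigma_preimage coor A -> g_sigma_preimage coor (~` A).
Proof. exact: sigma_algebraC. Qed.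

Let rV_bigcup (F : (set 'rV[R]_n)^nat) :
  (forall i, g_sigma_preimage coor (F i)) ->
  g_sigma_preimage coor (\bigcup_i (F i)).
Proof. exact: sigma_algebra_bigcup. Qed.

(* The Borel sigma-algebra of R^n, generated by the coordinates. *)
HB.instance Definition _ := @isMeasurable.Build default_measure_display
  'rV[R]_n (g_sigma_preimage coor) rV_set0 rV_setC rV_bigcup.

End rV_measurable.

Lemma measurable_coor (R : realType) (n : nat) (i : 'I_n) :
  measurable_fun [set: 'rV[R]_n] (fun x : 'rV[R]_n => x ord0 i).
Proof.
move=> _ A mA; apply: sub_sigma_algebra.
case: n i => [[] []//|n i].
rewrite -bigcup_mkord_ord.
exists i; first exact: ltn_ord.
by exists A => //; rewrite inord_val.
Qed.

Lemma measurable_fun_rVP (R : realType) (n : nat) d (T : measurableType d)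
    (f : T -> 'rV[R]_n) :
  measurable_fun [set: T] f <->
  forall i, measurable_fun [set: T] (fun x => f x ord0 i).
Proof.
split=> [mf i|mf]; first exact: measurableT_comp (@measurable_coor R n i) mf.
suff: g_sigma_preimage (fun (i : 'I_n) (y : 'rV[R]_n) => y ord0 i) `<=`
    [set A | measurable (f @^-1` A)].
  by move=> h _ A mA; rewrite setTI; exact: h.
apply: smallest_sub.
  split=> [|A|F mF] /=; first by rewrite preimage_set0.
  - by rewrite setTD preimage_setC => /measurableC.
  - by rewrite preimage_bigcup; apply: bigcupT_measurable => k; exact: mF.
case: n f mf => [|n] f mf; first by rewrite big_ord0.
rewrite -bigcup_mkord_ord => C [i _ [B mB <-]].
by rewrite setTI /= -comp_preimage -[X in measurable X]setTI; exact: mf.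
Qed.

Definition rV_cons {R : realType} {n : nat} (p : R * 'rV[R]_n) : 'rV[R]_n.+1 :=
  \row_i (if unlift ord0 i is Some j then p.2 ord0 j else p.1).

Lemma measurable_rV_cons {R : realType} {n : nat} :
  measurable_fun [set: R * 'rV[R]_n] (@rV_cons R n).
Proof.
apply/measurable_fun_rVP => i; case: (unliftP ord0 i) => [j|] ->.
- rewrite (_ : (fun _ => _) = (fun x : 'rV[R]_n => x ord0 j) \o snd).
    exact: measurableT_comp (measurable_coor j) measurable_snd.
  by apply/funext => p /=; rewrite mxE liftK.
- rewrite (_ : (fun _ => _) = fst); first exact: measurable_fst.
  by apply/funext => p /=; rewrite mxE unlift_none.
Qed.

Section measure_cons.
Context {R : realType} {n : nat}.
Variable m : {sigma_finite_measure set 'rV[R]_n -> \bar R}.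
Local Open Scope ereal_scope.

Definition measure_cons : set 'rV[R]_n.+1 -> \bar R :=
  pushforward (@lebesgue_measure R \x m) (@rV_cons R n).

Let measure_cons0 : measure_cons set0 = 0.
Proof. by rewrite /measure_cons /pushforward preimage_set0 measure0. Qed.

Let measure_cons_ge0 A : 0 <= measure_cons A.
Proof. by rewrite /measure_cons /pushforward; exact: measure_ge0. Qed.

Let measure_cons_sigma_additive : semi_sigma_additive measure_cons.
Proof.
move=> F mF tF mUF; rewrite /measure_cons /pushforward preimage_bigcup.
apply: measure_semi_sigma_additive.
- by move=> k; rewrite -[X in measurable X]setTI; exact: measurable_rV_cons.
- apply/trivIsetP => /= i j _ _ ij; rewrite -preimage_setI.
  by move/trivIsetP : tF => /(_ _ _ _ _ ij) ->//; rewrite preimage_set0.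
- rewrite -preimage_bigcup -[X in measurable X]setTI.
  exact: measurable_rV_cons.
Qed.

HB.instance Definition _ := isMeasure.Build _ _ _ measure_cons
  measure_cons0 measure_cons_ge0 measure_cons_sigma_additive.

Let rV_uncons (x : 'rV[R]_n.+1) : R * 'rV[R]_n :=
  (x ord0 ord0, \row_j x ord0 (lift ord0 j)).

Let measurable_rV_uncons : measurable_fun [set: 'rV[R]_n.+1] rV_uncons.
Proof.
apply: measurable_fun_pair; first exact: measurable_coor.
apply/measurable_fun_rVP => i.
rewrite (_ : (fun _ => _) = (fun x : 'rV[R]_n.+1 => x ord0 (lift ord0 i))).
  exact: measurable_coor.
by apply/funext => x; rewrite mxE.
Qed.

Let rV_consK : cancel (@rV_cons R n) rV_uncons.
Proof.
move=> [t x]; rewrite /rV_uncons /rV_cons /= mxE unlift_none; congr pair.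
by apply/rowP => j; rewrite !mxE liftK.
Qed.

Let measure_cons_sigma_finite : sigma_finite setT measure_cons.
Proof.
have /sigma_finiteP[F [UF ndF Foo]] := sigma_finiteT (@lebesgue_measure R).
have /sigma_finiteP[G [UG ndG Goo]] := sigma_finiteT m.
exists (fun k => rV_uncons @^-1` (F k `*` G k)).
  apply/esym; rewrite -preimage_bigcup -subTset => x _ /=.
  have: [set: R] (rV_uncons x).1 by [].
  rewrite [X in X _]UF => -[i _ Fi].
  have: [set: 'rV[R]_n] (rV_uncons x).2 by [].
  rewrite [X in X _]UG => -[j _ Gj].
  exists (maxn i j) => //; split.
    by move: Fi; exact/subsetPset/ndF/leq_maxl.
  by move: Gj; exact/subsetPset/ndG/leq_maxr.
move=> k; have [mF Fk] := Foo k; have [mG Gk] := Goo k.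
have mFG : measurable (F k `*` G k) by exact: measurableX.
split.
  by rewrite -[X in measurable X]setTI; exact: measurable_rV_uncons.
rewrite /measure_cons /pushforward -comp_preimage.
rewrite (_ : _ \o _ = idfun) ?preimage_id; last exact/funext/rV_consK.
by rewrite product_measure1E// lte_mul_pinfty// ge0_fin_numE.
Qed.

HB.instance Definition _ := Measure_isSigmaFinite.Build _ _ _ measure_cons
  measure_cons_sigma_finite.

End measure_cons.

(* Lebesgue measure on (the Borel sets of) R^n. *)
Fixpoint lebesgue_rV (R : realType) (n : nat) :
    {sigma_finite_measure set 'rV[R]_n -> \bar R} :=
  match n with
  | 0 => @dirac _ 'rV[R]_0 0 R
  | n'.+1 => measure_cons (lebesgue_rV R n')
  end.

Lemma lebesgue_rV_box (R : realType) (n : nat) (A : 'I_n -> set R) :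
  (forall i, measurable (A i)) ->
  lebesgue_rV R n [set x | forall i, A i (x ord0 i)] =
  (\prod_(i < n) lebesgue_measure (A i))%E.
Proof.
elim: n A => [|n IHn] A mA.
  rewrite big_ord0 /= diracE mem_set//= => -[]//.
rewrite big_ord_recl -(IHn (fun j => A (lift ord0 j)))//.
have mB : measurable
    [set x : 'rV[R]_n | forall i, A (lift ord0 i) (x ord0 i)].
  rewrite (_ : mkset _ =
      \bigcap_(j in [set: 'I_n]) [set x : 'rV[R]_n | A (lift ord0 j) (x ord0 j)]).
    apply: fin_bigcap_measurable => // j _.
    by rewrite -[X in measurable X]setTI; exact: (measurable_coor j).
  by apply/seteqP; split=> x /= Ax; [move=> j _|move=> j]; exact: Ax.
rewrite /= /measure_cons /pushforward.
rewrite -(product_measure1E lebesgue_measure (lebesgue_rV R n) (mA ord0) mB).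
congr (product_measure1 _ _ _); apply/seteqP; split=> -[t x] /=.
- move=> Ax; split=> [|j].
    by have := Ax ord0; rewrite mxE unlift_none.
  by have := Ax (lift ord0 j); rewrite mxE liftK.
- move=> [At Ax] i; rewrite mxE; by case: (unliftP ord0 i) => [j|] ->/=.
Qed.

(* Lebesgue measure on R^N x R; a point of space-time is a pair (x, t). *)
Definition lebesgue_xt (R : realType) (N : nat) :
    {measure set ('rV[R]_N * measurableTypeR R) -> \bar R} :=
  (lebesgue_rV R N \x @lebesgue_measure R)%E.

Section Lebesgue_spaces.
Context d (T : measurableType d) (R : realType).
Variable mu : {measure set T -> \bar R}.
Implicit Types (D : set T) (f : T -> R).

(* Measurability with respect to the completion of the sigma-algebra of T.
   With mu a Lebesgue measure on Borel sets this is Lebesgue measurability.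
   The library's integral of a function that is measurable in this sense is
   its integral against the completion of mu: the supremum over the
   mu-measurable simple functions below a nonnegative function does not see
   null sets. *)
Definition lmeasurable D f : Prop :=
  forall B : set R, measurable B ->
    completed_algebra_gen mu (D `&` f @^-1` B).

Definition in_L1 D f : Prop :=
  lmeasurable D f /\ (\int[mu]_(x in D) `|f x|%:E < +oo)%E.

Definition in_L2 D f : Prop :=
  lmeasurable D f /\ (\int[mu]_(x in D) ((f x) ^+ 2)%:E < +oo)%E.

End Lebesgue_spaces.

Section smooth.
Context {R : realType} {V : normedModType R}.

Definition iter_deriv (s : seq V) (f : V -> R) : V -> R :=
  foldr (fun v g => 'D_v g) f s.

Definition smooth (f : V -> R) : Prop :=
  forall (s : seq V) (x : V),
    {for x, continuous (iter_deriv s f)} /\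
    forall v, derivable (iter_deriv s f) x v.

(* C_c^oo(Q), each function being extended by zero to the whole space *)
Definition test_fun (Q : set V) (phi : V -> R) : Prop :=
  smooth phi /\
  exists K, [/\ compact K, K `<=` Q & forall x, ~ K x -> phi x = 0].

(* The boundary is C^oo: near each of its points, Omega is the sublevel set
   of a smooth local defining function with nonvanishing gradient. *)
Definition smooth_boundary (Omega : set V) : Prop :=
  forall p, closure Omega p -> ~ Omega p ->
  exists (U : set V) (h : V -> R),
    [/\ open U, U p, smooth h,
        forall x, U x -> (Omega x <-> h x < 0) &
        forall x, U x -> exists v, 'D_v h x != 0].

Definition bounded_smooth_domain (Omega : set V) : Prop :=
  [/\ Omega !=set0, open Omega, connected Omega, bounded_set Omega &
      smooth_boundary Omega].

End smooth.

Section Sobolev.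
Context {R : realType} {N : nat}.
Local Notation space := 'rV[R]_N.
Local Notation spacetime := ('rV[R]_N * R)%type.
Local Notation mu := (lebesgue_xt R N).
Implicit Types (Q : set spacetime) (f g phi : spacetime -> R).

Definition e_t : spacetime := (0, 1).
Definition e_x (j : 'I_N) : spacetime := (delta_mx ord0 j, 0).

(* the coordinate directions of space-time: None is time *)
Definition axis (o : option 'I_N) : spacetime :=
  if o is Some j then e_x j else e_t.

Definition is_weak_deriv Q (v : spacetime) f g : Prop :=
  forall phi, test_fun Q phi ->
    \int[mu]_(z in Q) (f z * 'D_v phi z) = - \int[mu]_(z in Q) (g z * phi z).

(* The weak derivative in L^2(Q), a junk value if there is none; it is
   determined by f up to a null set. *)
Definition weak_deriv Q (v : spacetime) f : spacetime -> R :=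
  xget (fun=> 0) [set g | in_L2 mu Q g /\ is_weak_deriv Q v f g].

Definition in_H1 Q f : Prop :=
  in_L2 mu Q f /\
  forall o, exists2 g, in_L2 mu Q g & is_weak_deriv Q (axis o) f g.

Definition H1_normsq Q f : \bar R :=
  (\int[mu]_(z in Q) ((f z) ^+ 2)%:E +
   \sum_(o : option 'I_N)
      \int[mu]_(z in Q) ((weak_deriv Q (axis o) f z) ^+ 2)%:E)%E.

(* the sequence u of test functions on Q converges to phi in H^1(Q) *)
Definition test_approx Q (u : nat -> spacetime -> R) phi : Prop :=
  (forall n, test_fun Q (u n)) /\
  H1_normsq Q (fun z => u n z - phi z) @[n --> \oo] --> 0%E.

Definition in_H10 Q phi : Prop :=
  in_H1 Q phi /\ exists u, test_approx Q u phi.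

Definition cylinder (Omega : set space) (T : R) : set spacetime :=
  Omega `*` `]0, T[.

Definition half_cylinder (Omega : set space) : set spacetime :=
  Omega `*` [set t | 0 <= t].

End Sobolev.

Section time_derivative.
Context {R : realType}.
Implicit Types (f : R -> R) (t : R).

(* Derivatives on [0, +oo), one-sided at 0. *)
Definition diff_quotient_ge0 f t : set_system R :=
  (f s - f t) / (s - t) @[s --> within [set s | 0 <= s] t^'].

Definition derivable_ge0 f t : Prop := cvg (diff_quotient_ge0 f t).

Definition deriv_ge0 f t : R := lim (diff_quotient_ge0 f t).

Definition cont_diff_ge0 f : Prop :=
  {within [set t | 0 <= t], continuous f} /\
  forall t, 0 <= t -> derivable_ge0 f t.

End time_derivative.

Section system.
Context {R : realType} {N k : nat}.
Local Notation space := 'rV[R]_N.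
Local Notation spacetime := ('rV[R]_N * R)%type.
Local Notation leb := (lebesgue_rV R N).
Local Notation mu := (lebesgue_xt R N).

Variable Omega : set space.
Variable a : 'I_k -> 'I_k -> R -> space -> R.
Variable f : 'I_k -> R -> space -> R -> R.
Variable beta : R -> space -> R.
Variable d : 'I_k -> R -> R.
Variable r : 'I_k -> space -> R.

Definition weight (U : space -> R) : Prop :=
  lmeasurable leb Omega U /\ forall x, Omega x -> 0 < U x.

Definition competition_hyp (U1 : space -> R) : Prop :=
  [/\ forall i j, lmeasurable mu (half_cylinder Omega) (fun z => a i j z.2 z.1),
      forall i t x, 0 <= t -> Omega x -> a i i t x = 0,
      forall i j t x, 0 <= t -> Omega x -> i != j ->
        a i j t x = a j i t x /\ 0 <= a i j t x,
      forall i j x, Omega x -> cont_diff_ge0 (fun t => a i j t x) &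
      exists A1 A2 : R, [/\ 0 <= A1, 0 <= A2 &
        forall i j t x, 0 <= t -> Omega x ->
          a i j t x <= A1 * expR (A2 * t) * U1 x /\
          `|deriv_ge0 (fun s => a i j s x) t| <= A1 * expR (A2 * t) * U1 x]].

Definition reaction_hyp (U2 : space -> R) (H2 : R) : Prop :=
  [/\ forall i s, lmeasurable mu (half_cylinder Omega) (fun z => f i z.2 z.1 s),
      forall i t x, 0 <= t -> Omega x -> continuous (f i t x),
      forall i t x s, 0 <= t -> Omega x ->
        (s <= 0 -> 0 <= f i t x s) /\ (1 <= s -> f i t x s <= 0),
      forall i x s, Omega x -> cont_diff_ge0 (fun t => f i t x s) &
      exists (H1 : R) (I : set R),
        [/\ 0 <= H1, 0 <= H2, open I, `[0, 1] `<=` I &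
          forall i t x s, 0 <= t -> Omega x -> I s ->
            `|f i t x s| <= H1 * expR (H2 * t) * U2 x /\
            `|deriv_ge0 (fun t' => f i t' x s) t|
               <= H1 * expR (H2 * t) * U2 x]].

Definition beta_hyp (U3 : space -> R) : Prop :=
  [/\ lmeasurable mu (half_cylinder Omega) (fun z => beta z.2 z.1),
      forall t x, 0 <= t -> Omega x -> 0 < beta t x,
      forall x, Omega x -> cont_diff_ge0 (beta ^~ x) &
      exists C1 C2 : R, [/\ 0 < C1, 0 < C2 &
        forall t x, 0 <= t -> Omega x ->
          beta t x <= C1 * expR (C2 * t) * U3 x /\
          `|deriv_ge0 (beta ^~ x) t| <= C1 * expR (C2 * t) * U3 x]].

Definition diffusion_hyp (D2 : R) : Prop :=
  [/\ forall i t, 0 <= t -> 0 < d i t,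
      forall i, cont_diff_ge0 (d i) &
      exists (D1 D3 : R) (rho : R -> R),
        [/\ [/\ 0 < D1, 0 <= D2 & 0 <= D3],
            forall t, 0 <= t -> 0 < rho t,
            forall t0 : R, 0 <= t0 ->
              exists M : R, \forall t \near t0, 0 <= t -> (rho t)^-1 <= M &
            forall i t, 0 <= t ->
              [/\ rho t <= d i t, d i t <= D1 * expR (D2 * t) &
                  `|deriv_ge0 (d i) t| <= D3 * d i t]]].

Definition density_hyp : Prop :=
  (forall i, lmeasurable leb Omega (r i)) /\
  exists R1 R2 : R, [/\ 0 < R1, 0 < R2 &
    forall i x, Omega x -> R1 <= r i x <= R2].

Definition coefficient_hyp (D2 H2 : R) : Prop :=
  exists U1 U2 U3 : space -> R,
    [/\ [/\ weight U1, weight U2 & weight U3],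
        in_L1 leb Omega (fun x => U1 x * U3 x) /\ in_L1 leb Omega U2,
        competition_hyp U1 /\ reaction_hyp U2 H2,
        beta_hyp U3 & diffusion_hyp D2 /\ density_hyp].

Variable w : 'I_k -> spacetime -> R.

(* the two terms of the equation that are only in L^1 *)
Definition zero_order (i : 'I_k) (z : spacetime) : R :=
  f i z.2 z.1 (w i z) -
  beta z.2 z.1 * w i z * \sum_(j < k | j != i) a i j z.2 z.1 * (w j z) ^+ 2.

(* In the second clause the pairing of the zero-order terms with phi in
   H^1_0 is the limit of their pairings with test functions tending to phi;
   this is what it means for the equation to hold in H^-1. *)
Definition weak_solution : Prop :=
  [/\ forall T i, 0 < T -> in_H1 (cylinder Omega T) (w i),
      forall i, {ae mu, forall z, half_cylinder Omega z -> 0 <= w i z <= 1} &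
      forall T i, 0 < T ->
        let Q := cylinder Omega T in
        let dt := weak_deriv Q e_t in
        let dx j := weak_deriv Q (e_x j) in
        (forall phi, test_fun Q phi ->
          \int[mu]_(z in Q)
            (r i z.1 * dt (w i) z * phi z +
             d i z.2 * (\sum_(j < N) dx j (w i) z * 'D_(e_x j) phi z) -
             zero_order i z * phi z) = 0) /\
        (forall phi u, in_H10 Q phi -> test_approx Q u phi ->
          \int[mu]_(z in Q) (zero_order i z * u n z) @[n --> \oo] -->
          \int[mu]_(z in Q)
            (r i z.1 * dt (w i) z * phi z +
             d i z.2 * (\sum_(j < N) dx j (w i) z * dx j phi z)))].

(* W t is w(t), the value at t of the representative of w that is continuous
   in time with values in L^2(Omega)^k. *)
Definition continuous_repr (W : R -> 'I_k -> space -> R) : Prop :=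
  [/\ forall t i, 0 <= t -> in_L2 leb Omega (W t i),
      forall t0 i, 0 <= t0 ->
        (\int[leb]_(x in Omega) ((W t i x - W t0 i x) ^+ 2)%:E)%E
          @[t --> within [set t | 0 <= t] (nbhs t0)] --> 0%E &
      forall i, {ae @lebesgue_measure R, forall t, 0 < t ->
        {ae leb, forall x, Omega x -> W t i x = w i (x, t)}}].

Definition in_L1loc (g : space -> R) : Prop :=
  forall K, compact K -> K `<=` Omega -> in_L1 leb K g.

Definition cvg_L1loc (W : R -> 'I_k -> space -> R) (v : 'I_k -> space -> R) :
    Prop :=
  forall i K, compact K -> K `<=` Omega ->
    (\int[leb]_(x in K) `|W t i x - v i x|%:E)%E @[t --> +oo%R] --> 0%E.

Definition segregated (v : 'I_k -> space -> R) : Prop :=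
  forall i j, i != j -> {ae leb, forall x, Omega x -> v i x * v j x = 0}.

End system.

(* Main.v *)
(** Test the equation for [w i] against bumps [psi(x) chi(t - s)] supported in a
    unit time slab. Integrating by parts, the time-derivative and diffusion
    terms are bounded independently of [s], since [w] and the coefficients [r],
    [d] are bounded and the reaction is bounded by a fixed integrable function
    of [x]. Hence the coupling term is bounded too, and as it dominates
    [inf b] times a multiple of the integral of [w_i w_j^2 psi chi(. - s)],
    that integral tends to 0 as [s -> +oo]. By the convergence of [w(t)] it
    also tends to a positive multiple of the integral of [v_i v_j^2 psi], so
    [v_i v_j = 0] a.e. where [psi > 0].

    Since [r] is only measurable in [x] and [d] is not smooth, [r phi] and
    [d phi] are not test functions. This is circumvented by multiplying test
    functions by smooth functions of the other variables and passing to the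
    limit: indicators of orthants first, then all bounded Borel functions. *)
Require Import Defs.
From mathcomp Require Import all_boot all_order all_algebra.
From mathcomp Require Import all_classical all_reals all_analysis.
From mathcomp Require Import measurable_realfun ring lra.

Import Order.TTheory GRing.Theory Num.Theory.
Import numFieldNormedType.Exports.
Local Open Scope classical_set_scope.
Local Open Scope ring_scope.

Set Implicit Arguments.
Unset Strict Implicit.
Unset Printing Implicit Defensive.

(** The constant bounding the coupling integral must be chosen before the slab, while the upper
    bounds of [beta] and [a] grow exponentially in time. They therefore enter only where finiteness
    of an integral is at stake, and the estimate itself uses only lower bounds of [beta] and [a];
    [D2 = 0] and [H2 = 0] keep the diffusion and reaction bounds free of [s].

    Measurability of [f i t x (w i (x, t))] is never established, and the data are only Lebesgue
    measurable. Integrals of such functions are handled as lower integrals, monotone under a.e.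
    inequalities, while every integration by parts is carried out on Borel versions.

    Test functions come from an explicit algebra generated by P(1/y) exp(-1/y), closed under
    differentiation, so that smoothness of every order is automatic.

    The limit is not known beforehand to take values in [0, 1]. It is replaced by min(1, |v|), which
    has the same zeros and is no farther from [w]; then w_i w_j^2 and its limit differ by at most a
    multiple of L^1 distances. *)

(** * Flat functions and the algebra of smooth functions they generate *)

Section flat.
Context {R : realType}.
Implicit Types (P : {poly R}) (x y : R).

(** The polynomial parameter closes the family under differentiation: deriving P(1/y) exp(-1/y)
    replaces P by X^2 (P - P'). *)
Definition flat P y : R := if 0 < y then P.[y^-1] * expR (- y^-1) else 0.

Lemma flat_le0 P y : y <= 0 -> flat P y = 0.
Proof. by rewrite /flat ltNge => ->. Qed.

(** A single term x^n / n! of the exponential series already bounds exp x from below. *)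
Lemma exprn_expRN_le n x : 0 <= x -> x ^+ n * expR (- x) <= n`!%:R.
Proof.
move=> x0; rewrite expRN ler_pdivrMr ?expR_gt0//.
case: n => [|n]; first by rewrite expr0 mul1r -expR0 ler_expR.
rewrite mulrC -ler_pdivrMr ?ltr0n ?fact_gt0//.
by apply: le_trans (expR_ge1Dxn n x0); rewrite lerDr.
Qed.

Lemma horner_expRN_bounded P :
  exists2 C : R, 0 <= C & forall x, 0 <= x -> `|P.[x] * expR (- x)| <= C.
Proof.
exists (\sum_(i < size P) `|P`_i| * i`!%:R).
  by apply: sumr_ge0 => i _; rewrite mulr_ge0.
move=> x x0; rewrite horner_coef mulr_suml (le_trans (ler_norm_sum _ _ _))//.
apply: ler_sum => i _; rewrite -mulrA normrM ler_wpM2l//.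
by rewrite ger0_norm ?exprn_expRN_le// mulr_ge0 ?exprn_ge0 ?expR_ge0.
Qed.

Lemma flat_bounded P : exists2 C : R, 0 <= C & forall y, `|flat P y| <= C.
Proof.
have [C C0 PC] := horner_expRN_bounded P; exists C => // y.
rewrite /flat; case: ifPn => [y0|_]; last by rewrite normr0.
by apply: PC; rewrite invr_ge0 ltW.
Qed.

Lemma flat1_ge0 y : 0 <= flat 1 y.
Proof. by rewrite /flat; case: ifPn => // _; rewrite hornerC mul1r expR_ge0. Qed.

Lemma flat1_le1 y : flat 1 y <= 1.
Proof.
rewrite /flat; case: ifPn => // y0.
by rewrite hornerC mul1r -expR0 ler_expR oppr_le0 invr_ge0 ltW.
Qed.

Lemma flat1_gt0 y : (0 < flat 1 y) = (0 < y).
Proof.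
rewrite /flat; case: ifPn => [y0|_]; last by rewrite ltxx.
by rewrite hornerC mul1r expR_gt0.
Qed.

(* This is what makes [flat P] differentiable at 0. *)
Lemma flat_quadratic P :
  exists2 C : R, 0 <= C & forall y, `|flat P y| <= C * y ^+ 2.
Proof.
have [C C0 PC] := flat_bounded ('X^2 * P); exists C => // y.
have := PC y; rewrite /flat; case: ifPn => [y0|_ _]; last first.
  by rewrite normr0 mulr_ge0 ?sqr_ge0.
rewrite hornerM hornerXn -mulrA normrM ger0_norm ?sqr_ge0// => H.
rewrite -ler_pdivrMr ?exprn_gt0//; apply: le_trans H.
by rewrite exprVn mulrC.
Qed.

Lemma is_derive_flat P y :
  is_derive y 1 (flat P) (flat ('X^2 * (P - P^`())) y).
Proof.
have [y0|y0|->] := ltgtP y 0.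
- rewrite flat_le0 ?ltW//.
  apply: (@near_eq_is_derive _ _ _ (cst 0)).
  near=> z; rewrite flat_le0//; apply/ltW; near: z.
  exact: lt_nbhsl.
- have y0' : y != 0 by rewrite gt_eqF.
  apply: (@near_eq_is_derive _ _ _
    ((horner P \o GRing.inv) * (expR \o (-%R \o GRing.inv)))).
    near=> z; rewrite /flat ifT//; near: z; exact: lt_nbhsr.
  have dV : is_derive y 1 (GRing.inv : R -> R) (- y ^- 2).
    apply: (trigger_derive (@is_deriveV _ id y 1 1 y0' (is_derive_id _ _))).
    by rewrite /GRing.scale /= mulr1.
  have dP : is_derive (y^-1) 1 (horner P) (P^`()).[y^-1].
    by apply: DeriveDef; [exact: derivable_horner|rewrite -derive1E -derivE].
  have d1 := is_derive1_comp dP dV.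
  have dN : is_derive y 1 (-%R \o GRing.inv : R -> R) (y ^- 2).
    have := is_deriveN dV; rewrite opprK; exact.
  have d2 := @is_derive1_comp _ expR (-%R \o GRing.inv) y _ _ (is_derive_expR (- y^-1)) dN.
  apply: (trigger_derive (is_deriveM d1 d2)).
  rewrite /flat y0 /= !hornerE /GRing.scale /=.
  by field.
- rewrite flat_le0//; have [C C0 PC] := flat_quadratic P.
  (* [C] may be zero; [C + 1] makes [e / (C + 1)] a legitimate radius. The difference quotient at 0
     is at most C |h| by [flat_quadratic]. *)
  have C1 : 0 < C + 1 by rewrite ltr_wpDl.
  have lim : h^-1 *: ((flat P \o shift 0) (h *: 1) - flat P 0) @[h --> 0^'] --> 0.
    apply/cvgr0Pnorm_le => e e0; near=> h.
    rewrite /= addr0 (flat_le0 P (lexx 0))// subr0 /GRing.scale /= mulr1 normrM normfV.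
    have h0 : 0 < `|h| by rewrite normr_gt0; near: h; exact: nbhs_dnbhs_neq.
    rewrite ler_pdivrMl//; apply: le_trans (PC h) _.
    rewrite -real_normK ?num_real// expr2 mulrA mulrC ler_wpM2l// ltW//.
    apply: (@le_lt_trans _ _ ((C + 1) * `|h|)); first by apply: ler_wpM2r => //; rewrite lerDl.
    rewrite mulrC -ltr_pdivlMr//; near: h; apply: dnbhs0_lt; rewrite divr_gt0//.
  apply: DeriveDef; first by apply/cvg_ex; exists 0.
  exact/cvg_lim.
Unshelve. all: by end_near. Qed.

End flat.

Section elem.
Context {R : realType} {N : nat}.
Local Notation spacetime := ('rV[R]_N * R)%type.
Implicit Types (P : {poly R}) (z v : spacetime) (o : option 'I_N).

Definition axis_coord o z : R := if o is Some j then z.1 ord0 j else z.2.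

Lemma axis_coord_axis o o' : axis_coord o (axis o') = (o == o')%:R.
Proof.
case: o o' => [j|] [j'|] //=; rewrite ?mxE ?eqxx//= ?(inj_eq Some_inj)//.
Qed.

Lemma axis_coordD o z v (h : R) : axis_coord o (h *: v + z) = h * axis_coord o v + axis_coord o z.
Proof. by case: o => [j|] //=; rewrite !mxE. Qed.

Lemma continuous_coord o : continuous (axis_coord o).
Proof.
case: o => [j|] z /=; last exact: cvg_snd.
by apply: (continuous_comp (@cvg_fst _ _ _ _ _) (@coord_continuous _ _ _ ord0 j _)).
Qed.

Lemma measurable_coord o :
  measurable_fun [set: 'rV[R]_N * measurableTypeR R] (axis_coord o).
Proof.
case: o => [j|]; last exact: measurable_snd.
exact: measurableT_comp (measurable_coor j) measurable_fst.
Qed.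

(* An algebra of globally bounded smooth functions, stable under directional
   derivatives. *)
Inductive elem : (spacetime -> R) -> Prop :=
| elem_cst c : elem (fun=> c)
| elem_flat P o k c : elem (fun z => flat P (k * axis_coord o z + c))
| elem_add f g : elem f -> elem g -> elem (fun z => f z + g z)
| elem_mul f g : elem f -> elem g -> elem (fun z => f z * g z).

Lemma elem_prod (I : Type) (s : seq I) (f : I -> spacetime -> R) :
  (forall i, elem (f i)) -> elem (fun z => \prod_(i <- s) f i z).
Proof.
move=> ef; elim: s => [|i s IH].
  by rewrite (_ : (fun _ => _) = fun=> 1); [exact: elem_cst|
    apply/funext => z; rewrite big_nil].
rewrite (_ : (fun _ => _) = fun z => f i z * \prod_(j <- s) f j z).
  exact: elem_mul.
by apply/funext => z; rewrite big_cons.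
Qed.

(** An arbitrary real direction [a], possibly 0, is needed because along a space-time vector [v] the
    argument of [flat P] moves at speed [k * axis_coord o v]. *)
Lemma is_derive_flat_dir P (y a : R) :
  is_derive y a (flat P) (a * flat ('X^2 * (P - P^`())) y).
Proof.
have [d1 e1] := is_derive_flat P y.
have df : differentiable (flat P) y by apply/derivable1_diffP.
apply: DeriveDef; first exact: diff_derivable.
by rewrite deriveE// diff1E// derive1E e1.
Qed.

(** The argument is affine in [z], so the difference quotient along [v] is literally one of [flat P]
    on the line; no chain rule is involved. *)
Lemma is_derive_flat_coord P o k c z v :
  is_derive z v (fun z => flat P (k * axis_coord o z + c))
    (flat ('X^2 * (P - P^`())) (k * axis_coord o z + c) * (k * axis_coord o v)).
Proof.
have [d1 e1] := is_derive_flat_dir P (k * axis_coord o z + c) (k * axis_coord o v).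
have E : (fun h : R => h^-1 *: (((fun z => flat P (k * axis_coord o z + c)) \o shift z)
     (h *: v) - (fun z => flat P (k * axis_coord o z + c)) z)) =
  (fun h : R => h^-1 *: ((flat P \o shift (k * axis_coord o z + c))
     (h *: (k * axis_coord o v)) - flat P (k * axis_coord o z + c))).
  apply/funext => h /=; congr (_ *: (flat P _ - _)).
  by rewrite axis_coordD /GRing.scale /=; ring.
apply: DeriveDef; first by rewrite /derivable E.
by rewrite /derive E -/(derive _ _ _) e1 mulrC.
Qed.

Lemma elem_is_derive f v : elem f ->
  exists2 g, elem g & forall z, is_derive z v f (g z).
Proof.
elim=> {f} [c|P o k c|f1 f2 _ [g1 e1 d1] _ [g2 e2 d2]|f1 f2 f1e [g1 e1 d1] f2e [g2 e2 d2]].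
- by exists (fun=> 0); [exact: elem_cst|move=> z; exact: is_derive_cst].
- eexists; last by move=> z; exact: is_derive_flat_coord.
  by apply: elem_mul; [exact: elem_flat|exact: elem_cst].
- exists (fun z => g1 z + g2 z); first exact: elem_add.
  by move=> z; exact: is_deriveD.
- exists (fun z => f1 z * g2 z + f2 z * g1 z).
    by apply: elem_add; apply: elem_mul.
  by move=> z; exact: is_deriveM.
Qed.

Lemma elem_derivable f v z : elem f -> derivable f z v.
Proof. by move=> /(elem_is_derive v)[g _ /(_ z)[]]. Qed.

Lemma elem_derive f v : elem f -> elem ('D_v f).
Proof.
move=> /(elem_is_derive v)[g eg dg]; rewrite (_ : 'D_v f = g)//.
by apply/funext => z; rewrite derive_val.
Qed.

Lemma elem_continuous f : elem f -> continuous f.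
Proof.
elim=> {f} [c|P o k c|f1 f2 _ c1 _ c2|f1 f2 _ c1 _ c2] z.
- exact: cst_continuous.
- have cf : {for k * axis_coord o z + c, continuous (flat P)}.
    apply: differentiable_continuous; apply/derivable1_diffP.
    by have [] := is_derive_flat P (k * axis_coord o z + c).
  apply: (@continuous_comp _ _ _ (fun z => k * axis_coord o z + c) (flat P)) => //.
  apply: cvgD; last exact: cvg_cst.
  by apply: cvgMr; exact: continuous_coord.
- by apply: cvgD; [exact: c1|exact: c2].
- by apply: cvgM; [exact: c1|exact: c2].
Qed.

Lemma elem_smooth f : elem f -> smooth f.
Proof.
move=> ef s z; have es : elem (iter_deriv s f).
  by elim: s => //= v s; exact: elem_derive.
by split; [exact: elem_continuous|move=> v; exact: elem_derivable].
Qed.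

Lemma elem_bounded f : elem f -> exists2 C : R, 0 <= C & forall z, `|f z| <= C.
Proof.
elim=> {f} [c|P o k c|f1 f2 _ [C1 p1 b1] _ [C2 p2 b2]|
    f1 f2 _ [C1 p1 b1] _ [C2 p2 b2]].
- by exists `|c|.
- by have [C C0 Cb] := flat_bounded P; exists C.
- exists (C1 + C2) => [|z]; first exact: addr_ge0.
  by rewrite (le_trans (ler_normD _ _))// lerD.
- exists (C1 * C2) => [|z]; first exact: mulr_ge0.
  by rewrite normrM ler_pM.
Qed.

Lemma measurable_flat P : measurable_fun [set: R] (flat P).
Proof.
apply: continuous_measurable_fun => y.
apply: differentiable_continuous; apply/derivable1_diffP.
by have [] := is_derive_flat P y.
Qed.

(** By induction on the construction rather than from continuity, since the sigma-algebra of
    space-time is generated by coordinates, not by open sets. *)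
Lemma elem_measurable f : elem f ->
  measurable_fun [set: 'rV[R]_N * measurableTypeR R] f.
Proof.
elim=> {f} [c|P o k c|f1 f2 _ m1 _ m2|f1 f2 _ m1 _ m2].
- exact: measurable_cst.
- apply: (measurableT_comp (measurable_flat P)).
  apply: measurable_funD => //; apply: measurable_funM => //.
  exact: measurable_coord.
- exact: measurable_funD.
- exact: measurable_funM.
Qed.

Lemma deriveMe (f g : spacetime -> R) v z : elem f -> elem g ->
  'D_v (fun z => f z * g z) z = f z * 'D_v g z + g z * 'D_v f z.
Proof.
move=> ef eg; rewrite (@deriveM _ _ f g)//; exact: elem_derivable.
Qed.

Lemma derive_off (f : spacetime -> R) (K : set spacetime) v z :
  closed K -> (forall z, ~ K z -> f z = 0) -> ~ K z -> 'D_v f z = 0.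
Proof.
move=> cK f0 Kz; rewrite (@near_eq_derive _ _ _ f (cst 0)) ?derive_cst//.
have : open (~` K) by rewrite openC.
rewrite openE => /(_ z Kz); apply: filterS => y /=; exact: f0.
Qed.

End elem.

(** * A.e. comparison of integrals without measurability, Borel versions, dominated convergence *)

Section lower_integral.
Local Open Scope ereal_scope.
Context d (T : measurableType d) (R : realType).
Variable mu : {measure set T -> \bar R}.
Import HBNNSimple.

(** The integral of a nonnegative function is a supremum over simple functions below it. Setting
    such a function to zero on the exceptional null set keeps its integral and puts it below [g]. *)
Lemma ge0_ae_le_lower_integral (f g : T -> \bar R) :
  (forall x, 0 <= f x) -> (forall x, 0 <= g x) ->
  {ae mu, forall x, f x <= g x} -> \int[mu]_x f x <= \int[mu]_x g x.
Proof.
move=> f0 g0 [M [mM M0 fgM]].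
rewrite !ge0_integralTE//; apply: ge_ereal_sup => _ [h /= hf <-].
have mMC : measurable (~` M) by exact: measurableC.
apply: (@le_trans _ _ (sintegral mu (proj_nnsfun h mMC))); last first.
  apply: ereal_sup_ubound; exists (proj_nnsfun h mMC) => //= x.
  rewrite mindicE; have [xM|xM] := boolP (x \in ~` M); last by rewrite mulr0.
  rewrite mulr1; apply: le_trans (hf x) _.
  by apply: contrapT => fg; move/set_mem : xM; apply; exact: fgM.
rewrite -!integralT_nnsfun le_eqVlt; apply/orP; left; apply/eqP.
apply: ae_eq_integral => //; try exact/measurable_EFinP.
exists M; split => // x /= H; apply: contrapT => xM; apply: H => _.
by rewrite /= mindicE mem_set// mulr1.
Qed.

(** Positive and negative parts are compared separately, the latter in the reverse order. *)
Lemma ae_le_lower_integral (D : set T) (f g : T -> \bar R) :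
  {ae mu, forall x, D x -> f x <= g x} ->
  \int[mu]_(x in D) f x <= \int[mu]_(x in D) g x.
Proof.
move=> fg; rewrite integral_mkcond [leRHS]integral_mkcond integralE [leRHS]integralE.
apply: leeB; apply: ge0_ae_le_lower_integral => //.
- apply: filterS fg => {}x fgx; rewrite !funeposE !patchE; case: ifPn => //.
  move=> /set_mem/fgx fg; rewrite ge_max le_max fg/=.
  by rewrite le_max lexx orbT.
- apply: filterS fg => {}x fgx; rewrite !funenegE !patchE; case: ifPn => //.
  move=> /set_mem/fgx fg; rewrite ge_max !le_max leeN2 fg/=.
  by rewrite lexx orbT.
Qed.

Lemma ae_eq_lower_integral (D : set T) (f g : T -> \bar R) :
  {ae mu, forall x, D x -> f x = g x} ->
  \int[mu]_(x in D) f x = \int[mu]_(x in D) g x.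
Proof.
move=> fg; apply/eqP; rewrite eq_le; apply/andP; split;
  by apply: ae_le_lower_integral; apply: filterS fg => x fg /fg ->.
Qed.

End lower_integral.

Section borel_version.
Context d (T : measurableType d) (R : realType).
Variable mu : {measure set T -> \bar R}.

(** Countably many level sets determine [f], and each is Borel up to a null set; off the union of
    these null sets [f] is Borel, and [g] is set to 0 there and outside [D]. The clause
    [g x = f x \/ g x = 0] lets the sign of [f] pass to [g] everywhere. *)
Lemma lmeasurable_version (D : set T) (f : T -> R) : measurable D ->
  lmeasurable mu D f ->
  exists g : T -> R, [/\ measurable_fun [set: T] g,
    forall x, g x = f x \/ g x = 0,
    forall x, ~ D x -> g x = 0 &
    {ae mu, forall x, D x -> f x = g x}].
Proof.
move=> mD lf.
have [u uP] : exists u : nat -> R, forall x y, x < y -> exists n, x < u n < y.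
  exists (fun n => if unpickle n is Some q then ratr q else 0) => x y xy.
  have [q qxy] := rat_in_itvoo xy; exists (pickle q).
  by rewrite pickleK; rewrite in_itv in qxy.
have H n : exists AM : set T * set T, [/\ measurable AM.1, measurable AM.2,
    mu AM.2 = 0%E, forall x, AM.1 x -> D x /\ u n < f x &
    forall x, D x -> u n < f x -> AM.1 x \/ AM.2 x].
  have [A mA [B [M [mM M0 BM]] AB]] := lf _ (measurable_itv `]u n, +oo[).
  exists (A, M); split => // x.
    move=> Ax; have : (A `|` B) x by left.
    by rewrite AB => -[Dx]; rewrite /preimage /mkset in_itv andbT.
  move=> Dx fx; have : (A `|` B) x by rewrite AB; split => //; rewrite /preimage /mkset in_itv andbT.
  by case=> [?|/BM ?]; [left|right].
pose AM n := projT1 (cid (H n)).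
have AMP n : [/\ measurable (AM n).1, measurable (AM n).2,
    mu (AM n).2 = 0%E, forall x, (AM n).1 x -> D x /\ u n < f x &
    forall x, D x -> u n < f x -> (AM n).1 x \/ (AM n).2 x] := projT2 (cid (H n)).
move: AM AMP => AM AMP {H}.
pose M := \bigcup_n (AM n).2.
have mM : measurable M by apply: bigcupT_measurable => n; have [] := AMP n.
have M0 : mu M = 0%E.
  apply/negligibleP => //; apply: negligible_bigcup => n.
  by apply/negligibleP; have [] := AMP n.
have mf : measurable_fun (D `\` M) f.
  apply: (measurability _ (RGenOInfty.measurableE R)) => _ [_ [c ->]] <-.
  (* By density of [u], the set where [c < f] is the union of the sets where [u n < f] over all
     [u n > c]. *)
  rewrite (_ : _ `&` _ = \bigcup_(n in [set n | c < u n]) ((AM n).1 `\` M)).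
    by apply: bigcup_measurable => n _; apply: measurableD => //; have [] := AMP n.
  apply/seteqP; split=> [x [[Dx Mx]]|x [n cu [Ax Mx]]].
    rewrite /preimage /mkset in_itv andbT => cf.
    have [n /andP[cu uf]] := uP _ _ cf; exists n => //; split => //.
    by have [_ _ _ _ /(_ x Dx uf)[//|AMx]] := AMP n; case: Mx; exists n.
  have [_ _ _ /(_ x Ax)[Dx uf] _] := AMP n.
  by split => //; rewrite /preimage /mkset in_itv andbT; exact: lt_trans cu uf.
exists (f \_ (D `\` M)); split.
- exact/(measurable_restrictT f (measurableD mD mM)).
- by move=> x; rewrite patchE; case: ifP; [left|right].
- by move=> x Dx; rewrite patchE memNset// => -[].
- exists M; split => // x /= Hx; apply: contrapT => Mx; apply: Hx => Dx.
  by rewrite patchE mem_set.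
Qed.

End borel_version.

Section integrable_real.
Context d (T : measurableType d) (R : realType).
Variable mu : {measure set T -> \bar R}.

Lemma integrable_le_bound (f g : T -> R) : measurable_fun [set: T] f ->
  (forall x, `|f x| <= g x) ->
  mu.-integrable [set: T] (EFin \o g) -> mu.-integrable [set: T] (EFin \o f).
Proof.
move=> mf fg; apply: le_integrable => //; first exact/measurable_EFinP.
by move=> x _ /=; rewrite lee_fin (le_trans (fg x))// ler_norm.
Qed.

Lemma integrableM_bounded (f h : T -> R) (C : R) : measurable_fun [set: T] h ->
  (forall x, `|h x| <= C) ->
  mu.-integrable [set: T] (EFin \o f) ->
  mu.-integrable [set: T] (EFin \o (fun x => f x * h x)).
Proof.
move=> mh hC fi; have C0 : [set: T] !=set0 -> 0 <= C.
  by move=> [x _]; exact: le_trans (hC x).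
have mf := measurable_int _ fi; move/measurable_EFinP in mf.
apply: (@integrable_le_bound _ (fun x => C * `|f x|)).
- exact: measurable_funM.
- by move=> x; rewrite normrM mulrC ler_wpM2r.
- exact: (integrableZl _ C (integrable_norm fi)).
Qed.

Lemma integral_dominated_cvg0 (H : T -> R) (m : nat -> T -> R) (q : T -> R) (C : R) :
  mu.-integrable [set: T] (EFin \o H) ->
  (forall n, measurable_fun [set: T] (m n)) ->
  measurable_fun [set: T] q ->
  (forall n z, `|m n z| <= C) ->
  (forall z, m ^~ z @ \oo --> q z) ->
  (forall n, (\int[mu]_z (H z * m n z)%:E)%E = 0%E) ->
  (\int[mu]_z (H z * q z)%:E)%E = 0%E.
Proof.
move=> Hi mm mq mC mq_cvg m0.
have mH := measurable_int _ Hi; move/measurable_EFinP in mH.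
have mHm n : measurable_fun [set: T] (fun z => (H z * m n z)%:E).
  by apply/measurable_EFinP; exact: measurable_funM.
have mHq : measurable_fun [set: T] (fun z => (H z * q z)%:E).
  by apply/measurable_EFinP; exact: measurable_funM.
have cvg_Hm : {ae mu, forall z, [set: T] z ->
    (fun n => (H z * m n z)%:E) @ \oo --> (H z * q z)%:E}.
  by apply/aeW => z _; apply: cvg_EFin; [exact: nearW|apply: cvgMr; exact: mq_cvg].
have dom_i : mu.-integrable [set: T] (fun z => (`|C| * `|H z|)%:E).
  exact: (integrableZl _ _ (integrable_norm Hi)).
have dom_le : {ae mu, forall z n, [set: T] z ->
    (`|(H z * m n z)%:E| <= (`|C| * `|H z|)%:E)%E}.
  apply/aeW => z n _; rewrite /= lee_fin normrM mulrC ler_wpM2r//.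
  by rewrite (le_trans (mC n z))// ler_norm.
have [_ _ /cvg_lim <-//] :=
  dominated_convergence measurableT mHm mHq cvg_Hm dom_i dom_le.
by under eq_fun do rewrite m0; exact: lim_cst.
Qed.

End integrable_real.

(** * From smooth cutoffs to bounded Borel multipliers of test functions *)

Section orthogonal.
Context d d' (Z : measurableType d) (X : measurableType d') (R : realType).
Variables (mu : {measure set Z -> \bar R}) (H : Z -> R) (p : Z -> X).
Hypothesis Hi : mu.-integrable [set: Z] (EFin \o H).
Hypothesis mp : measurable_fun [set: Z] p.
Import HBNNSimple.

Let mpre A : measurable A -> measurable (p @^-1` A).
Proof. by move=> mA; rewrite -[X in measurable X]setTI; exact: mp. Qed.

(** The sets whose preimage gives [H] a zero integral form a Dynkin system; for complements,
    [G setT] makes the total integral of [H] vanish. *)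
Lemma orthogonal_sets (G : set (set X)) :
  @measurable _ X = <<s G >> -> setI_closed G -> G setT ->
  (forall A, G A -> (\int[mu]_(z in p @^-1` A) (H z)%:E)%E = 0%E) ->
  forall A, measurable A -> (\int[mu]_(z in p @^-1` A) (H z)%:E)%E = 0%E.
Proof.
move=> sG GI GT G0 A; rewrite sG; move: A.
have mH := measurable_int _ Hi.
apply: (dynkin_induction sG GI) => // [|S mS S0|F mF tF F0].
- exact: G0.
- have := G0 _ GT; rewrite preimage_setT -(setUv (p @^-1` S)) integral_setU//.
  + by rewrite S0 add0e preimage_setC.
  + exact: mpre.
  + by apply: measurableC; exact: mpre.
  + by rewrite setUv.
  + by apply/disj_setPS; rewrite setICr.
- rewrite preimage_bigcup integral_bigcup//.
  + by rewrite eseries0.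
  + apply/trivIsetP => i j _ _ ij; rewrite -preimage_setI.
    by move/trivIsetP : tF => /(_ _ _ _ _ ij) ->//; rewrite preimage_set0.
  + by move=> k; exact: mpre.
  + apply: integrableS Hi => //; apply: bigcup_measurable => k _; exact: mpre.
Qed.

(** Simple functions approximate [q] monotonically from below, hence stay below [C], and [C |H|]
    dominates the products. *)
Lemma orthogonal_fun (q : X -> R) (C : R) :
  (forall A, measurable A -> (\int[mu]_(z in p @^-1` A) (H z)%:E)%E = 0%E) ->
  measurable_fun [set: X] q -> (forall x, 0 <= q x <= C) ->
  (\int[mu]_z (H z * q (p z))%:E)%E = 0%E.
Proof.
move=> H0 mq qC.
have mEq : measurable_fun setT (EFin \o q) by exact/measurable_EFinP.
pose g := nnsfun_approx measurableT mEq.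
have gq x : g ^~ x @ \oo --> q x.
  have q0 y : setT y -> (0 <= (EFin \o q) y)%E.
    by move=> _; rewrite lee_fin; have /andP[] := qC y.
  by have /fine_cvgP[_] := cvg_nnsfun_approx measurableT mEq q0 (I : setT x).
have gle n x : `|g n x| <= C.
  rewrite ger0_norm//; have /andP[_] := qC x; apply: le_trans.
  have nd : nondecreasing_seq (g ^~ x).
    by move=> a b ab; exact/lefP/nd_nnsfun_approx.
  have cg : cvgn (g ^~ x) by apply/cvg_ex; exists (q x).
  by have := nondecreasing_cvgn_le nd cg n; rewrite (cvg_lim _ (gq x)).
have mC n z : `|g n (p z)| <= C by exact: gle.
apply: (integral_dominated_cvg0 Hi _ _ mC) => //.
- by move=> n; exact: measurableT_comp.
- exact: measurableT_comp.
have key c A : measurable A ->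
    mu.-integrable [set: Z] (EFin \o (fun z => H z * (c * \1_A (p z)))) /\
    (\int[mu]_z (H z * (c * \1_A (p z)))%:E)%E = 0%E.
  move=> mA; split.
    apply: (@integrableM_bounded _ _ _ _ H _ `|c|) => //.
      by apply: measurable_funM => //; exact: measurableT_comp.
    move=> z; rewrite normrM indicE.
    by case: (_ \in _); rewrite ?normr1 ?normr0 ?mulr1 ?mulr0.
  transitivity (\int[mu]_z (c%:E * ((EFin \o H) \_ (p @^-1` A)) z))%E.
    apply: eq_integral => z _; rewrite patchE /= indicE mulrCA EFinM.
    have -> : (p z \in A) = (z \in p @^-1` A) by [].
    by case: ifP => _; rewrite ?mulr1 ?mulr0.
  rewrite integralZl//.
    by rewrite -integral_mkcond H0 ?mule0.
  by rewrite -integrable_mkcond; [apply: integrableS Hi => //|]; exact: mpre.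
move=> n; under eq_integral => z _ do
  rewrite (fimfunEord (g n) (p z)) mulr_sumr -sumEFin.
by rewrite integral_sum//= => [|i]; [apply: big1 => i _|]; apply key.
Qed.

End orthogonal.

Section orthants.
Context {R : realType} {X I : Type} (c : I -> X -> R).

(** Encoded by a finite list of strict lower bounds, repetitions allowed, so that intersecting is
    concatenating and the empty list gives the whole space. *)
Definition orthant (l : seq (I * R)) : set X :=
  [set x | all (fun ia => ia.2 < c ia.1 x) l].

Definition orthants : set (set X) := range orthant.

Lemma orthants_setI : setI_closed orthants.
Proof.
move=> _ _ [l _ <-] [l' _ <-]; exists (l ++ l') => //.
by apply/seteqP; split=> x; rewrite /orthant /= all_cat => /andP.
Qed.

Lemma orthants_setT : orthants setT.
Proof. by exists [::] => //; apply/seteqP; split. Qed.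

End orthants.

Lemma orthant_measurable (R : realType) d (X : measurableType d) (I : Type)
    (c : I -> X -> R) l :
  (forall i, measurable_fun [set: X] (c i)) -> measurable (orthant c l).
Proof.
move=> mc; elim: l => [|[i a] l IH].
  by rewrite (_ : orthant _ _ = setT)//; apply/seteqP; split.
rewrite (_ : orthant _ _ = c i @^-1` `]a, +oo[ `&` orthant c l).
  apply: measurableI => //; rewrite -[X in measurable X]setTI.
  exact: mc.
apply/seteqP; split=> x; rewrite /orthant /= in_itv /= andbT; first by move=> /andP.
by move=> [-> ->].
Qed.

Lemma measurable_orthants_R (R : realType) :
  @measurable _ (measurableTypeR R) = <<s orthants (fun (_ : unit) (x : R) => x) >>.
Proof.
apply/seteqP; split.
  rewrite [X in X `<=` _](_ : _ = <<s @RGenOInfty.G R >>); last exact: RGenOInfty.measurableE.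
  apply: smallest_sub; first exact: smallest_sigma_algebra.
  move=> _ [a ->]; apply: sub_sigma_algebra; exists [:: (tt, a)] => //.
apply: smallest_sub; first exact: sigma_algebra_measurable.
by move=> _ [l _ <-]; apply: orthant_measurable.
Qed.

Lemma measurable_orthants_rV (R : realType) (n : nat) :
  @measurable _ 'rV[R]_n =
  <<s orthants (fun (i : 'I_n) (x : 'rV[R]_n) => x ord0 i) >>.
Proof.
apply/seteqP; split; last first.
  apply: smallest_sub; first exact: sigma_algebra_measurable.
  by move=> _ [l _ <-]; apply: orthant_measurable => i; exact: measurable_coor.
set G := orthants _.
have mc (i : 'I_n) : measurable_fun [set: g_sigma_algebraType G]
    (fun x : 'rV[R]_n => x ord0 i).
  apply: (measurability _ (RGenOInfty.measurableE R)) => _ [_ [a ->]] <-.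
  rewrite setTI; apply: sub_sigma_algebra; exists [:: (i, a)] => //.
rewrite /measurable /=; apply: smallest_sub; first exact: smallest_sigma_algebra.
case: n @G mc => [|n] G mc; first by rewrite big_ord0.
rewrite -bigcup_mkord_ord => C [i _ [B mB <-]].
exact: mc.
Qed.

Section step_cutoff.
Context {R : realType}.

(** Rescaled copies of [flat 1] smooth the Heaviside function; the limit is 0 at [y = 0], in
    agreement with the strict inequalities of [orthant]. *)
Lemma flat1_cvg (y : R) :
  (fun n : nat => flat 1 (n%:R * y)) @ \oo --> ((0 < y)%R%:R : R).
Proof.
have [y0|y0] := ltP 0 y; last first.
  rewrite (_ : (fun n => _) = fun=> 0); first exact: cvg_cst.
  by apply/funext => n; rewrite flat_le0// mulr_ge0_le0.
have lim : (fun n : nat => expR (- (n%:R * y)^-1)) @ \oo --> (1 : R).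
  suff lim0 : (fun n : nat => - (n%:R * y)^-1) @ \oo --> (0 : R).
    by have := cvg_comp _ _ lim0 (@continuous_expR R 0); rewrite expR0.
  rewrite -oppr0; apply: cvgN.
  rewrite (_ : (fun n => _) = (fun n : nat => n%:R^-1 * y^-1)); last first.
    by apply/funext => n; rewrite invfM.
  rewrite -(mul0r y^-1); apply: cvgMl.
  apply/gtr0_cvgV0; last exact: cvgr_idn.
  by near=> n; rewrite ltr0n; near: n; exact: nbhs_infty_gt.
apply: cvg_trans lim; apply: near_eq_cvg; near=> n.
have n0 : 0 < n%:R * y.
  by rewrite mulr_gt0// ltr0n; near: n; exact: nbhs_infty_gt.
by rewrite /flat n0 hornerC mul1r.
Unshelve. all: by end_near. Qed.

End step_cutoff.

Section multiplier.
Context {R : realType} {N : nat}.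
Local Notation spacetime := ('rV[R]_N * R)%type.
Local Notation mu := (lebesgue_xt R N).
Variables (I : Type) (e : I -> option 'I_N).

(** The map [e] selects the variables allowed in the cutoff: the space coordinates against a time
    derivative, time alone against a space derivative. The argument has the affine shape of
    [elem_flat]. *)
Definition cutoff (l : seq (I * R)) (n : nat) (z : spacetime) : R :=
  \prod_(ia <- l) flat 1 (n%:R * axis_coord (e ia.1) z + - (n%:R * ia.2)).

Lemma elem_cutoff l n : elem (cutoff l n).
Proof. by apply: elem_prod => ia; exact: elem_flat. Qed.

Lemma cutoff_ge0_le1 l n z : 0 <= cutoff l n z <= 1.
Proof.
rewrite /cutoff; elim: l => [|ia l IH]; first by rewrite big_nil ler01 lexx.
have /andP[IH0 IH1] := IH; rewrite big_cons mulr_ge0 ?flat1_ge0//=.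
by rewrite mulr_ile1 ?flat1_ge0 ?flat1_le1.
Qed.

Lemma cutoff_cvg l z : cutoff l ^~ z @ \oo -->
  ((all (fun ia => ia.2 < axis_coord (e ia.1) z) l)%:R : R).
Proof.
elim: l => [|ia l IH] /=.
  by under eq_fun do rewrite /cutoff big_nil; exact: cvg_cst.
under eq_fun do rewrite /cutoff big_cons -mulrN -mulrDr.
rewrite -mulnb natrM; apply: cvgM; last exact: IH.
by rewrite -subr_gt0; exact: flat1_cvg.
Qed.

Lemma derive_cutoff o l n z : (forall i, e i != o) ->
  'D_(axis o) (cutoff l n) z = 0.
Proof.
move=> eo; rewrite /derive.
rewrite (_ : (fun h => _) = fun=> 0); first exact: lim_cst.
apply/funext => h /=.
suff -> : cutoff l n (h *: axis o + z) = cutoff l n z by rewrite subrr scaler0.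
apply: eq_bigr => ia _; rewrite axis_coordD axis_coord_axis.
by rewrite (negbTE (eo _)) mulr0 add0r.
Qed.

Variables (d : measure_display) (X : measurableType d) (c : I -> X -> R).
Variables (p : spacetime -> X) (o : option 'I_N).
Hypothesis mp : measurable_fun [set: 'rV[R]_N * measurableTypeR R] p.
Hypothesis gen : @measurable _ X = <<s orthants c>>.
Hypothesis mc : forall i, measurable_fun [set: X] (c i).
Hypothesis cp : forall i z, c i (p z) = axis_coord (e i) z.
Hypothesis eo : forall i, e i != o.

(* The cutoffs do not depend on the variable of differentiation, so they can
   multiply a test function; in the limit they become indicators of orthants. *)
Lemma weak_deriv_multiplier (Q K : set spacetime) (f g th : spacetime -> R)
    (q : X -> R) (C : R) :
  compact K -> K `<=` Q -> elem th -> (forall z, ~ K z -> th z = 0) ->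
  is_weak_deriv Q (axis o) f g ->
  mu.-integrable [set: _] (EFin \o (fun z => f z * 'D_(axis o) th z)) ->
  mu.-integrable [set: _] (EFin \o (fun z => g z * th z)) ->
  measurable_fun [set: X] q -> (forall x, 0 <= q x <= C) ->
  (\int[mu]_z (g z * th z * q (p z))%:E =
   - \int[mu]_z (f z * 'D_(axis o) th z * q (p z))%:E)%E.
Proof.
move=> cK KQ eth thK wd if_ ig mq qC.
have cK' : closed K.
  apply: compact_closed => //; exact: norm_hausdorff.
(* [H] is the full integrand of the weak-derivative identity; the claim amounts to its orthogonality
   to every bounded Borel function of [p z]. *)
pose H z := f z * 'D_(axis o) th z + g z * th z.
have iH : mu.-integrable [set: _] (EFin \o H).
  rewrite (_ : _ \o _ = (EFin \o (fun z => f z * 'D_(axis o) th z)) \+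
    (EFin \o (fun z => g z * th z))); last by apply/funext.
  exact: integrableD.
have mcut l n : measurable_fun [set: 'rV[R]_N * measurableTypeR R] (cutoff l n).
  by apply: elem_measurable; exact: elem_cutoff.
have cutle l n z : `|cutoff l n z| <= 1.
  by have /andP[c0 c1] := cutoff_ge0_le1 l n z; rewrite ger0_norm.
have Hcut l n : (\int[mu]_z (H z * cutoff l n z)%:E = 0)%E.
  have fi : mu.-integrable [set: _]
      (EFin \o (fun z => f z * 'D_(axis o) th z * cutoff l n z)).
    exact: (integrableM_bounded (mcut l n) (cutle l n)).
  have gi : mu.-integrable [set: _]
      (EFin \o (fun z => g z * th z * cutoff l n z)).
    exact: (integrableM_bounded (mcut l n) (cutle l n)).
  have Dthc z : 'D_(axis o) (fun z => th z * cutoff l n z) z =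
      'D_(axis o) th z * cutoff l n z.
    rewrite deriveMe//; last exact: elem_cutoff.
    by rewrite derive_cutoff// mulr0 add0r mulrC.
  have tQ : test_fun Q (fun z => th z * cutoff l n z).
    split; first by apply: elem_smooth; apply: elem_mul => //; exact: elem_cutoff.
    by exists K; split => // z /thK ->; rewrite mul0r.
  have := wd _ tQ; rewrite Rintegral_mkcond [in X in _ = - X]Rintegral_mkcond.
  rewrite (_ : patch _ _ _ = fun z => f z * 'D_(axis o) th z * cutoff l n z); last first.
    apply/funext => z; rewrite patchE Dthc; case: ifPn; first by rewrite mulrA.
    move=> /negP zQ; rewrite (derive_off _ cK' thK); first by rewrite mulr0 mul0r.
    by move=> Kz; apply: zQ; rewrite inE; exact: KQ.
  rewrite (_ : patch _ _ _ = fun z => g z * th z * cutoff l n z); last first.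
    apply/funext => z; rewrite patchE; case: ifPn; first by rewrite mulrA.
    move=> /negP zQ; rewrite thK; first by rewrite mulr0 mul0r.
    by move=> Kz; apply: zQ; rewrite inE; exact: KQ.
  move=> fg; under eq_integral => z _ do rewrite /H mulrDl EFinD.
  rewrite integralD//.
  rewrite -[X in (X + _)%E]fineK ?integrable_fin_num//.
  rewrite -[X in (_ + X)%E]fineK ?integrable_fin_num//.
  rewrite -EFinD; congr EFin.
  by move: fg; rewrite /Rintegral => ->; rewrite addNr.
have Horth A : orthants c A -> (\int[mu]_(z in p @^-1` A) (H z)%:E = 0)%E.
  move=> [l _ <-].
  have morth : measurable (p @^-1` orthant c l).
    rewrite -[X in measurable X]setTI.
    by apply: mp => //; exact: orthant_measurable.
  rewrite integral_mkcond.
  transitivity (\int[mu]_z (H z * \1_(p @^-1` orthant c l) z)%:E)%E.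
    apply: eq_integral => z _; rewrite patchE /= indicE.
    by case: ifP => _; rewrite ?mulr1 ?mulr0.
  apply: (integral_dominated_cvg0 iH (mcut l) _ (cutle l) _ (Hcut l)).
  - exact: measurable_indic.
  - move=> z; have := cutoff_cvg (l := l) (z := z); rewrite indicE.
    suff -> : (z \in p @^-1` orthant c l) =
      all (fun ia : I * R => ia.2 < axis_coord (e ia.1) z) l by [].
    apply/idP/idP; rewrite inE /orthant /=; first by under eq_all do rewrite cp.
    by under [X in _ -> is_true X]eq_all do rewrite cp.
have Hq := orthogonal_fun iH mp (orthogonal_sets iH mp gen
  (@orthants_setI _ _ _ c) (@orthants_setT _ _ _ c) Horth) mq qC.
have mqp : measurable_fun [set: 'rV[R]_N * measurableTypeR R] (q \o p).
  exact: measurableT_comp.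
have qpC z : `|(q \o p) z| <= C.
  by have /andP[q0 q1] := qC (p z); rewrite /= ger0_norm.
have fi : mu.-integrable [set: _]
    (EFin \o (fun z => f z * 'D_(axis o) th z * q (p z))).
  exact: (integrableM_bounded mqp qpC).
have gi : mu.-integrable [set: _] (EFin \o (fun z => g z * th z * q (p z))).
  exact: (integrableM_bounded mqp qpC).
move: Hq; under eq_integral => z _ do rewrite /H mulrDl EFinD.
rewrite integralD//.
rewrite -(fineK (integrable_fin_num measurableT fi)).
rewrite -(fineK (integrable_fin_num measurableT gi)) -EFinD => -[/eqP].
by rewrite addrC addr_eq0 => /eqP ->; rewrite EFinN.
Qed.

End multiplier.

(** * Boxes in space, and null sets and sections in space-time *)

Section boxes.
Context {R : realType} {N : nat}.
Implicit Types (al be : 'I_N -> R).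

Definition cbox al be : set 'rV[R]_N :=
  [set x | forall i, `[al i, be i]%classic (x ord0 i)].

Definition obox al be : set 'rV[R]_N :=
  [set x | forall i, `]al i, be i[%classic (x ord0 i)].

Lemma compact_cbox al be : compact (cbox al be).
Proof.
apply: (@rV_compact _ N (fun i => `[al i, be i]%classic)) => i.
exact: segment_compact.
Qed.

Lemma measurable_box (A : 'I_N -> set R) : (forall i, measurable (A i)) ->
  measurable [set x : 'rV[R]_N | forall i, A i (x ord0 i)].
Proof.
move=> mA.
rewrite (_ : mkset _ = \bigcap_(j in [set: 'I_N])
    [set x : 'rV[R]_N | A j (x ord0 j)]).
  apply: fin_bigcap_measurable => // j _.
  by rewrite -[X in measurable X]setTI; exact: (measurable_coor j).
by apply/seteqP; split=> x /= Ax; [move=> j _|move=> j]; exact: Ax.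
Qed.

Lemma measurable_cbox al be : measurable (cbox al be).
Proof. exact: (measurable_box (A := fun i => `[al i, be i]%classic)). Qed.

Lemma measurable_obox al be : measurable (obox al be).
Proof. exact: (measurable_box (A := fun i => `]al i, be i[%classic)). Qed.

Lemma lebesgue_cbox_lty al be : (lebesgue_rV R N (cbox al be) < +oo)%E.
Proof.
rewrite (lebesgue_rV_box (A := fun i => `[al i, be i]%classic))//.
rewrite ltey_eq; apply/orP; left; apply: (big_rec (fun x : \bar R => x \is a fin_num)) => [//|i x _ xfin].
rewrite fin_numM// lebesgue_measure_itv; case: ifP => // _.
Qed.

(** Boxes of side 2/(n+1) centred on the lattice Z^N/(n+1). Being countable, the family shows that
    open sets are Borel, and later reduces an a.e. statement on [Omega] to one on boxes. *)
Definition grid_lo (nk : nat * 'rV[int]_N) (i : 'I_N) : R :=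
  (nk.2 ord0 i - 1)%:~R / nk.1.+1%:R.
Definition grid_hi (nk : nat * 'rV[int]_N) (i : 'I_N) : R :=
  (nk.2 ord0 i + 1)%:~R / nk.1.+1%:R.

Lemma open_grid (Om : set 'rV[R]_N) x : open Om -> Om x -> exists nk,
  cbox (grid_lo nk) (grid_hi nk) `<=` Om /\ obox (grid_lo nk) (grid_hi nk) x.
Proof.
move=> oOm Omx; have /nbhs_ballP[e /= e0 xe] : nbhs x Om by exact: open_nbhs_nbhs.
(* Two points of a box differ by at most 2/(n+1) in each coordinate. Extending one mesh width to
   each side of the rounded-down point puts [x] strictly inside. *)
have [n ne] : exists n : nat, 2 / e < n.+1%:R.
  exists (Num.truncn (2 / e)); rewrite truncnS_gt//.
have n0 : (0 : R) < n.+1%:R by [].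
pose k : 'rV[int]_N := \row_i Num.floor (x ord0 i * n.+1%:R).
exists (n, k).
have kx i : (k ord0 i)%:~R <= x ord0 i * n.+1%:R < (k ord0 i)%:~R + 1.
  rewrite mxE floor_le/=.
  by have := floorD1_gt (x ord0 i * n.+1%:R); rewrite intrD.
split; last first.
  move=> i; rewrite /= in_itv/= /grid_lo /grid_hi /=.
  rewrite ltr_pdivrMr// ltr_pdivlMr// !intrD.
  have /andP[k1 k2] := kx i.
  by apply/andP; split; lra.
move=> y /= Ky; apply: xe.
split => // i j; rewrite (ord1 i).
have := Ky j; rewrite /= in_itv/= /grid_lo /grid_hi /=.
rewrite ler_pdivrMr// ler_pdivlMr// !intrD => /andP[y1 y2].
have /andP[k1 k2] := kx j.
rewrite /ball/= -(@ltr_pM2r _ n.+1%:R)// -[X in _ * X]gtr0_norm// -normrM mulrBl.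
apply: (@le_lt_trans _ _ 2); last by rewrite -ltr_pdivrMl// mulrC.
by rewrite ler_norml; apply/andP; split; lra.
Qed.

Lemma open_measurable_rV (Om : set 'rV[R]_N) : open Om -> measurable Om.
Proof.
move=> oOm.
rewrite (_ : Om = \bigcup_(nk in [set: nat * 'rV[int]_N])
   (if `[< cbox (grid_lo nk) (grid_hi nk) `<=` Om >]
    then obox (grid_lo nk) (grid_hi nk) else set0)).
  apply: countable_bigcupT_measurable => // nk.
  case: ifP => // _; exact: measurable_obox.
apply/seteqP; split=> [x Omx|x [nk _]].
  have [nk [nk1 nk2]] := open_grid oOm Omx.
  by exists nk => //; rewrite ifT//; exact/asboolP.
case: ifP => // /asboolP sub bx; apply: sub => i; have := bx i.
by rewrite /= !in_itv/= => /andP[/ltW -> /ltW ->].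
Qed.

End boxes.

Section spacetime_measure.
Context {R : realType} {N : nat}.
Local Notation mu := (lebesgue_xt R N).
Local Notation leb := (lebesgue_rV R N).

Lemma integral_fst_slab (F : 'rV[R]_N -> \bar R) (J : set R) :
  measurable_fun [set: _] F -> (forall x, 0 <= F x)%E ->
  measurable (J : set (measurableTypeR R)) ->
  (\int[mu]_z (F z.1 * (\1_J z.2)%:E) =
   \int[leb]_x F x * @lebesgue_measure R J)%E.
Proof.
move=> mF F0 mJ.
have mI : measurable_fun [set: measurableTypeR R] (fun t => (\1_J t)%:E : \bar R).
  by apply/measurable_EFinP; exact: measurable_indic.
rewrite /lebesgue_xt fubini_tonelli1; last 2 first.
- apply: emeasurable_funM; first exact: (measurableT_comp mF measurable_fst).
  exact: (measurableT_comp mI measurable_snd).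
- by move=> z; rewrite mule_ge0// lee_fin.
rewrite /fubini_F -ge0_integralZr//.
by apply: eq_integral => x _; rewrite /= ge0_integralZl// integral_indic// setIT.
Qed.

(** The infinite length of the time axis is harmless through the convention that 0 times infinity is
    0. *)
Lemma negligible_fst (A : set 'rV[R]_N) :
  leb.-negligible A -> mu.-negligible (A `*` setT).
Proof.
move=> [B [mB B0 AB]]; exists (B `*` setT); split.
- exact: measurableX.
- by rewrite [LHS](product_measure1E leb (@lebesgue_measure R) mB measurableT)
    [X in (X * _)%E](_ : _ = 0%E) ?mul0e.
- by move=> z [/AB].
Qed.

Lemma ae_fst (P : 'rV[R]_N -> Prop) :
  {ae leb, forall x, P x} -> {ae mu, forall z, P z.1}.
Proof.
move=> /negligible_fst; apply: negligibleS => z /= nP.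
by split.
Qed.

Lemma ae_ysection (P : 'rV[R]_N * R -> Prop) : {ae mu, forall z, P z} ->
  {ae @lebesgue_measure R, forall t, {ae leb, forall x, P (x, t)}}.
Proof.
move=> [M [mM M0 PM]].
have mI : measurable_fun [set: 'rV[R]_N * measurableTypeR R]
    (fun z => (\1_M z)%:E : \bar R).
  by apply/measurable_EFinP; exact: measurable_indic.
have I0 z : (0 <= (\1_M z)%:E :> \bar R)%E by rewrite lee_fin.
have mG := measurable_fun_fubini_tonelli_G (m1 := leb) _ mI I0.
have : (\int[@lebesgue_measure R]_t (\int[leb]_x (\1_M (x, t))%:E) = 0)%E.
  have := fubini_tonelli (m1 := leb) (m2 := @lebesgue_measure R) _ mI I0.
  rewrite /fubini_F /fubini_G => <-.
  have := fubini_tonelli1 (m1 := leb) (m2 := @lebesgue_measure R) _ mI I0.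
  by rewrite /fubini_F => <-; rewrite integral_indic// setIT.
move=> G0.
have : (\int[@lebesgue_measure R]_t `|\int[leb]_x (\1_M (x, t))%:E| = 0)%E.
  rewrite -[RHS]G0; apply: eq_integral => t _; rewrite gee0_abs//.
  exact: integral_ge0.
move/ae_eq_integral_abs => /(_ measurableT mG).
apply: filterS => t /(_ I) Mt.
exists (ysection M t); split.
- exact: measurable_ysection.
- transitivity (\int[leb]_x (\1_M (x, t))%:E)%E; last exact: Mt.
  rewrite (_ : (fun x => _) = fun x => (\1_(ysection M t) x)%:E); last first.
    by apply/funext => x; rewrite !indicE mem_ysection.
  by rewrite integral_indic ?setIT//; exact: measurable_ysection.
- by move=> x /= nP; apply/set_mem; rewrite mem_ysection; apply/mem_set; exact: PM.
Qed.

End spacetime_measure.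

(** * Bumps on a box times a unit time interval *)

Lemma derive_translate (R : numFieldType) (V W : normedModType R) (f : V -> W)
  (a v z : V) : 'D_v (fun y => f (a + y)) z = 'D_v f (a + z).
Proof.
rewrite /derive (_ : (fun h => h^-1 *: (((fun y => f (a + y)) \o shift z) (h *: v) -
  f (a + z))) = (fun h => h^-1 *: ((f \o shift (a + z)) (h *: v) - f (a + z))))//.
by apply/funext => h /=; rewrite addrCA.
Qed.

Lemma flat1_le (R : realType) : {homo @flat R 1 : x y / x <= y}.
Proof.
move=> x y xy; rewrite /flat; case: ifPn => [x0|_]; last exact: flat1_ge0.
have y0 : 0 < y by exact: lt_le_trans xy.
by rewrite y0 !hornerC !mul1r ler_expR lerN2 lef_pV2.
Qed.

Section bump.
Context {R : realType} {N : nat}.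
Variables al be : 'I_N -> R.

Definition space_bump (x : 'rV[R]_N) : R :=
  \prod_i (flat 1 (x ord0 i - al i) * flat 1 (be i - x ord0 i)).

Definition box_bump (s : R) (z : 'rV[R]_N * R) : R :=
  space_bump z.1 * (flat 1 (z.2 - s) * flat 1 (s + 1 - z.2)).

Lemma elem_bump s : elem (box_bump s).
Proof.
have e1 o a : elem (fun z : 'rV[R]_N * R => flat 1 (axis_coord o z - a)).
  rewrite (_ : (fun _ => _) = fun z => flat 1 (1 * axis_coord o z + - a)).
    exact: elem_flat.
  by apply/funext => z; rewrite mul1r.
have e2 o a : elem (fun z : 'rV[R]_N * R => flat 1 (a - axis_coord o z)).
  rewrite (_ : (fun _ => _) = fun z => flat 1 (-1 * axis_coord o z + a)).
    exact: elem_flat.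
  by apply/funext => z; rewrite mulN1r addrC.
apply: elem_mul.
  apply: elem_prod => i; apply: elem_mul; [exact: (e1 (Some i))|exact: (e2 (Some i))].
by apply: elem_mul; [exact: (e1 None)|exact: (e2 None)].
Qed.

Lemma space_bump_ge0 x : 0 <= space_bump x.
Proof. by apply: prodr_ge0 => i _; rewrite mulr_ge0 ?flat1_ge0. Qed.

Lemma space_bump_gt0 x : obox al be x -> 0 < space_bump x.
Proof.
move=> bx; apply: prodr_gt0 => i _; have := bx i; rewrite /= in_itv/= => /andP[x1 x2].
by rewrite mulr_gt0// flat1_gt0 subr_gt0.
Qed.

Lemma measurable_space_bump : measurable_fun [set: 'rV[R]_N] space_bump.
Proof.
rewrite /space_bump; apply: measurable_prod => i _.
apply: measurable_funM; apply: (measurableT_comp (measurable_flat 1)).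
  by apply: measurable_funB => //; exact: measurable_coor.
by apply: measurable_funB => //; exact: measurable_coor.
Qed.

Lemma bump_ge0 s z : 0 <= box_bump s z.
Proof. by rewrite !mulr_ge0 ?space_bump_ge0 ?flat1_ge0. Qed.

Lemma bump_off s z : ~ (cbox al be `*` `[s, s + 1]%classic) z -> box_bump s z = 0.
Proof.
move=> zK; apply/eqP; rewrite eq_le bump_ge0 andbT leNgt; apply/negP.
rewrite /box_bump => b0; apply: zK; split => /=.
  move=> i; rewrite /= in_itv/= !leNgt; apply/andP; split; apply/negP => H;
  move: b0; rewrite /space_bump (bigD1 i)//=.
    by rewrite (@flat_le0 _ 1 (_ - al i)) ?mul0r ?ltxx// subr_le0 ltW.
  by rewrite (@flat_le0 _ 1 (be i - _)) ?mulr0 ?mul0r ?ltxx// subr_le0 ltW.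
rewrite in_itv/= !leNgt; apply/andP; split; apply/negP => H; move: b0.
  by rewrite (@flat_le0 _ 1 (z.2 - s)) ?mul0r ?mulr0 ?ltxx// subr_le0 ltW.
by rewrite (@flat_le0 _ 1 (_ - z.2)) ?mul0r ?mulr0 ?ltxx// subr_le0 ltW.
Qed.

(** On the middle half of the slab both time factors have an argument of at least 1/4, and [flat 1]
    is nondecreasing. *)
Lemma bump_ge s z : `[s + 4^-1, s + 3 / 4]%classic z.2 ->
  space_bump z.1 * (flat 1 4^-1) ^+ 2 <= box_bump s z.
Proof.
rewrite /= in_itv/= => /andP[z1 z2]; rewrite ler_wpM2l ?space_bump_ge0// expr2.
by rewrite ler_pM ?flat1_ge0//; apply: flat1_le; lra.
Qed.

Lemma bump_translate s : box_bump s = fun z => box_bump 0 ((0, - s) + z).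
Proof.
apply/funext => -[x t]; rewrite /box_bump /= add0r; congr (_ * (flat 1 _ * flat 1 _)); ring.
Qed.

(** Uniformity in [s] comes from translation: every bump is a time shift of [box_bump 0]. Sums over
    the finitely many axes stand in for maxima. *)
Lemma bump_bounds : exists2 C : R, 0 <= C & forall s z, [/\ `|box_bump s z| <= C,
  forall o, `|'D_(axis o) (box_bump s) z| <= C &
  forall o, `|'D_(axis o) ('D_(axis o) (box_bump s)) z| <= C].
Proof.
have [C C0 Cb] := elem_bounded (elem_bump 0).
have /choice[C1 C1b] : forall o : option 'I_N, exists c : R, 0 <= c /\
    forall z, `|'D_(axis o) (box_bump 0) z| <= c.
  move=> o; have [c c0 cb] := elem_bounded (elem_derive (axis o) (elem_bump 0)).
  by exists c.
have /choice[C2 C2b] : forall o : option 'I_N, exists c : R, 0 <= c /\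
    forall z, `|'D_(axis o) ('D_(axis o) (box_bump 0)) z| <= c.
  move=> o; have [c c0 cb] := elem_bounded
    (elem_derive (axis o) (elem_derive (axis o) (elem_bump 0))).
  by exists c.
have S1 : 0 <= \sum_o C1 o by apply: sumr_ge0 => o _; have [] := C1b o.
have S2 : 0 <= \sum_o C2 o by apply: sumr_ge0 => o _; have [] := C2b o.
have D1 s v : 'D_v (box_bump s) = fun z => 'D_v (box_bump 0) ((0, - s) + z).
  by rewrite [in LHS]bump_translate; apply/funext => z; rewrite derive_translate.
exists (C + \sum_o C1 o + \sum_o C2 o) => [|s z]; first by rewrite !addr_ge0.
split=> [|o|o].
- by rewrite bump_translate (le_trans (Cb _))// -addrA lerDl addr_ge0.
- rewrite (congr1 (@^~ z) (D1 s (axis o))) (le_trans ((C1b o).2 _))//.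
  apply: (@le_trans _ _ (\sum_o C1 o)); last by rewrite addrAC lerDr addr_ge0.
  rewrite (bigD1 o)//= lerDl; apply: sumr_ge0 => o' _; by have [] := C1b o'.
- rewrite (D1 s (axis o)) (derive_translate ('D_(axis o) (box_bump 0))) (le_trans ((C2b o).2 _))//.
  apply: (@le_trans _ _ (\sum_o C2 o)); last by rewrite lerDr addr_ge0.
  rewrite (bigD1 o)//= lerDl; apply: sumr_ge0 => o' _; by have [] := C2b o'.
Qed.

End bump.

(** * Borel versions with good bounds, and integrability on slabs *)

Section versions.
Context d (T : measurableType d) (R : realType).
Variable mu : {measure set T -> \bar R}.

Lemma integral_supp (D : set T) (g : T -> \bar R) : (forall x, ~ D x -> g x = 0%E) ->
  (\int[mu]_(x in D) g x = \int[mu]_x g x)%E.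
Proof.
move=> g0; rewrite integral_mkcond; congr (integral _ _ _); apply/funext => x.
by rewrite patchE; case: ifPn => // /negP; rewrite inE => /g0 ->.
Qed.

Lemma in_L2_version (D : set T) (f : T -> R) : measurable D -> in_L2 mu D f ->
  exists g : T -> R, [/\ measurable_fun [set: T] g,
    mu.-integrable [set: T] (EFin \o (fun x => g x ^+ 2)) &
    {ae mu, forall x, D x -> f x = g x}].
Proof.
move=> mD [lf f2]; have [g [mg _ g0 fg]] := lmeasurable_version mD lf.
exists g; split => //; apply/integrableP; split.
  by apply/measurable_EFinP; exact: measurable_funX.
under eq_integral => x _ do rewrite /= ger0_norm ?sqr_ge0//.
rewrite -(@integral_supp D); last by move=> x /g0 ->; rewrite expr0n.
rewrite -(ae_eq_lower_integral (f := fun x => (f x ^+ 2)%:E))//.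
by apply: filterS fg => x H /H ->.
Qed.

Lemma in_L1_version (D : set T) (f : T -> R) : measurable D -> in_L1 mu D f ->
  (forall x, D x -> 0 <= f x) ->
  exists g : T -> R, [/\ measurable_fun [set: T] g, forall x, 0 <= g x,
    mu.-integrable [set: T] (EFin \o g) &
    {ae mu, forall x, D x -> f x = g x}].
Proof.
move=> mD [lf f1] f0; have [g [mg gf g0 fg]] := lmeasurable_version mD lf.
have gge0 x : 0 <= g x.
  have [Dx|/g0 ->//] := pselect (D x).
  by have [->|->//] := gf x; exact: f0.
exists g; split => //; apply/integrableP; split; first exact/measurable_EFinP.
rewrite -(@integral_supp D); last by move=> x /g0 /= ->; rewrite normr0.
rewrite -(ae_eq_lower_integral (f := fun x => `|f x|%:E))//.
by apply: filterS fg => x H /H ->.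
Qed.

(** Clamping a version to [0, C] turns a.e. bounds on [D] into bounds everywhere and leaves a.e.
    equality with [f] intact. *)
Lemma bounded_version (D : set T) (f : T -> R) (C : R) : 0 <= C -> measurable D ->
  lmeasurable mu D f -> {ae mu, forall x, D x -> 0 <= f x <= C} ->
  exists g : T -> R, [/\ measurable_fun [set: T] g, forall x, 0 <= g x <= C &
    {ae mu, forall x, D x -> f x = g x}].
Proof.
move=> C0 mD lf f01; have [g [mg _ _ fg]] := lmeasurable_version mD lf.
exists (fun x => Num.max 0 (Num.min C (g x))); split.
- apply: measurable_maxr => //; exact: measurable_minr.
- by move=> x; rewrite le_max lexx/= ge_max C0 ge_min lexx.
- apply: filterS2 f01 fg => x H1 H2 Dx; have /andP[f0 f1] := H1 Dx.
  by rewrite -(H2 Dx) min_r// max_r.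
Qed.

End versions.

#[global] Instance ae_filter_lebesgue_xt (R : realType) (N : nat) :
  Filter (nbhs (almost_everywhere (lebesgue_xt R N))).
Proof. exact: (ae_filter_ringOfSetsType (lebesgue_xt R N)). Qed.

Section slab.
Context {R : realType} {N : nat}.
Local Notation mu := (lebesgue_xt R N).
Local Notation leb := (lebesgue_rV R N).

Lemma integral_unit_slab (F : 'rV[R]_N -> R) (s : R) :
  measurable_fun [set: _] F -> (forall x, 0 <= F x) ->
  (\int[mu]_z (F z.1 * \1_(`[s, s + 1]%classic) z.2)%:E = \int[leb]_x (F x)%:E)%E.
Proof.
move=> mF F0; under eq_integral => z _ do rewrite EFinM.
rewrite (integral_fst_slab (F := EFin \o F))//.
- rewrite lebesgue_measure_itv /= lte_fin ltrDl ltr01 -EFinD addrC addKr mule1.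
  by [].
- exact/measurable_EFinP.
Qed.

Lemma integrable_unit_slab (F : 'rV[R]_N -> R) (s : R) :
  leb.-integrable [set: _] (EFin \o F) -> (forall x, 0 <= F x) ->
  mu.-integrable [set: _] (EFin \o (fun z => F z.1 * \1_(`[s, s + 1]%classic) z.2)).
Proof.
move=> iF F0; have mF := measurable_int _ iF; move/measurable_EFinP in mF.
apply/integrableP; split.
  apply/measurable_EFinP; apply: measurable_funM.
    exact: (measurableT_comp mF measurable_fst).
  by apply: (measurableT_comp _ measurable_snd); exact: measurable_indic.
under eq_integral => z _ do rewrite /= ger0_norm ?mulr_ge0//.
rewrite integral_unit_slab//.
have /integrableP[_] := iF; congr (_ < _)%E.
by apply: eq_integral => x _; rewrite /= ger0_norm.
Qed.

Lemma weak_deriv_version (Q : set ('rV[R]_N * R)) v f g f' g' :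
  {ae mu, forall z, Q z -> f z = f' z} -> {ae mu, forall z, Q z -> g z = g' z} ->
  is_weak_deriv Q v f g -> is_weak_deriv Q v f' g'.
Proof.
have ae_Rint (h h' k : 'rV[R]_N * R -> R) : {ae mu, forall z, Q z -> h z = h' z} ->
    (\int[mu]_(z in Q) (h z * k z) = \int[mu]_(z in Q) (h' z * k z))%R.
  move=> hh; congr fine; apply: ae_eq_lower_integral.
  by apply: filterS hh => z H /H ->.
move=> ff gg wd phi tphi.
by rewrite -(ae_Rint _ _ _ ff) -(ae_Rint _ _ _ gg) wd.
Qed.

End slab.

Section Rintegral_sum.
Context d (T : measurableType d) (R : realType).
Variable mu : {measure set T -> \bar R}.

Lemma integrable_Rsum (I : Type) (s : seq I) (f : I -> T -> R) :
  (forall i, mu.-integrable [set: T] (EFin \o f i)) ->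
  mu.-integrable [set: T] (EFin \o (fun x => \sum_(i <- s) f i x)).
Proof.
move=> fi; rewrite (_ : _ \o _ = fun x => (\sum_(i <- s) (f i x)%:E)%E).
  by apply: integrable_sum => // i _; exact: fi.
by apply/funext => x; rewrite /= sumEFin.
Qed.

Lemma Rintegral_sum (I : Type) (s : seq I) (f : I -> T -> R) :
  (forall i, mu.-integrable [set: T] (EFin \o f i)) ->
  (\int[mu]_x \sum_(i <- s) f i x = \sum_(i <- s) \int[mu]_x f i x)%R.
Proof.
move=> fi; elim: s => [|i s IH].
  rewrite big_nil; under eq_Rintegral do rewrite big_nil.
  by rewrite /Rintegral integral0.
rewrite big_cons -IH -RintegralD//; last exact: integrable_Rsum.
by apply: eq_Rintegral => x _; rewrite big_cons.
Qed.

Lemma integrable_supp (K : set T) (f : T -> R) (C : R) :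
  mu.-integrable [set: T] (EFin \o (\1_K : T -> R)) ->
  measurable_fun [set: T] f -> (forall x, `|f x| <= C) ->
  (forall x, ~ K x -> f x = 0) -> mu.-integrable [set: T] (EFin \o f).
Proof.
move=> iK mf fC f0; apply: (@integrable_le_bound _ _ _ _ _ (fun x => C * \1_K x)) => //.
  move=> x; have [Kx|Kx] := pselect (K x).
    by rewrite indicE mem_set// mulr1.
  by rewrite f0// normr0 indicE memNset// mulr0.
exact: (integrableZl _ C iK).
Qed.

(** Since |f| <= 1 + f^2, the product is dominated by [C * (\1_K + f ^+ 2)]. *)
Lemma integrable_L2_supp (K : set T) (f h : T -> R) (C : R) :
  mu.-integrable [set: T] (EFin \o (\1_K : T -> R)) ->
  measurable_fun [set: T] f ->
  mu.-integrable [set: T] (EFin \o (fun x => f x ^+ 2)) ->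
  measurable_fun [set: T] h -> (forall x, `|h x| <= C) ->
  (forall x, ~ K x -> h x = 0) ->
  mu.-integrable [set: T] (EFin \o (fun x => f x * h x)).
Proof.
move=> iK mf f2 mh hC h0.
apply: (@integrable_le_bound _ _ _ _ _ (fun x => C * (\1_K x + f x ^+ 2))).
- exact: measurable_funM.
- move=> x; have [Kx|Kx] := pselect (K x).
    rewrite indicE mem_set//= normrM mulrC ler_pM// -real_normK ?num_real//.
    by have := sqr_ge0 (`|f x| - 1); have := normr_ge0 (f x); nra.
  rewrite h0// mulr0 normr0 mulr_ge0// ?addr_ge0 ?sqr_ge0//.
  exact: le_trans (hC x).
- rewrite (_ : _ \o _ = fun x => (C%:E * ((\1_K x)%:E + (f x ^+ 2)%:E))%E)//.
  by apply: integrableZl => //; exact: integrableD.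
Qed.

(* [G] need not be measurable: it is only compared with integrable bounds. *)
Lemma Rintegral_sandwich0 (D : set T) (G lo up : T -> R) :
  mu.-integrable [set: T] (EFin \o lo) -> mu.-integrable [set: T] (EFin \o up) ->
  (forall x, ~ D x -> lo x = 0) -> (forall x, ~ D x -> up x = 0) ->
  {ae mu, forall x, D x -> lo x <= G x <= up x} ->
  (\int[mu]_(x in D) G x = 0)%R -> (\int[mu]_x lo x <= 0)%R.
Proof.
move=> ilo iup lo0 up0 logup G0.
have /= h1 : (\int[mu]_x (lo x)%:E <= \int[mu]_(x in D) (G x)%:E)%E.
  rewrite -(@integral_supp _ _ _ _ D); last by move=> x /lo0 ->.
  by apply: ae_le_lower_integral; apply: filterS logup => x H /H /andP[].
have /= h2 : (\int[mu]_(x in D) (G x)%:E <= \int[mu]_x (up x)%:E)%E.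
  rewrite -(@integral_supp _ _ _ _ D (EFin \o up)); last by move=> x /up0 /= ->.
  by apply: ae_le_lower_integral; apply: filterS logup => x H /H /andP[].
have flo := integrable_fin_num measurableT ilo.
have fup := integrable_fin_num measurableT iup.
(* A real-valued integral is 0 by default when the extended one is infinite; the bounds [lo] and
   [up] exclude this, so that the vanishing of the integral of [G] carries information. *)
have fG : (\int[mu]_(x in D) (G x)%:E)%E \is a fin_num.
  rewrite fin_numElt (lt_le_trans _ h1) ?(le_lt_trans h2)//.
    by rewrite ltey_eq fup.
  by rewrite ltNye_eq flo.
by rewrite -G0 /Rintegral fine_le.
Qed.

End Rintegral_sum.

(** * The weak form after integration by parts *)

Section weak_form.
Context {R : realType} {N : nat}.
Local Notation spacetime := ('rV[R]_N * R)%type.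
Local Notation mu := (lebesgue_xt R N).

(** Here [om], [ga], [rho], [del] stand for Borel versions of w_i, its weak derivatives, r_i and
    d_i, and [G] for the integrand of the equation. Subtracting the linear terms leaves minus the
    zero-order term times [phi], at least [A - h] with [A] a lower bound for the coupling. The upper
    bound [h'] only keeps the integral finite, hence its absence from the conclusion. *)
Lemma weak_form_estimate (Q K : set spacetime) (phi om G A h h' : spacetime -> R)
    (ga : option 'I_N -> spacetime -> R) (rho : 'rV[R]_N -> R) (del : R -> R)
    (C1 C2 : R) :
  let cross o z := om z * 'D_(axis o) ('D_(axis o) phi) z * del z.2 in
  compact K -> K `<=` Q -> mu.-integrable [set: _] (EFin \o (\1_K : _ -> R)) ->
  elem phi -> (forall z, ~ K z -> phi z = 0) ->
  measurable_fun [set: 'rV[R]_N * measurableTypeR R] om ->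
  (forall z, 0 <= om z <= 1) ->
  (forall o, [/\ measurable_fun [set: 'rV[R]_N * measurableTypeR R] (ga o),
    mu.-integrable [set: _] (EFin \o (fun z => ga o z ^+ 2)) &
    is_weak_deriv Q (axis o) om (ga o)]) ->
  measurable_fun [set: _] rho -> (forall x, 0 <= rho x <= C1) ->
  measurable_fun [set: measurableTypeR R] del -> (forall t, 0 <= del t <= C2) ->
  mu.-integrable [set: _] (EFin \o A) ->
  mu.-integrable [set: _] (EFin \o h) ->
  mu.-integrable [set: _] (EFin \o h') ->
  (forall z, ~ K z -> [/\ A z = 0, h z = 0 & h' z = 0]) ->
  {ae mu, forall z, Q z ->
    A z - h z <= G z -
      (rho z.1 * ga None z * phi z +
       del z.2 * \sum_j ga (Some j) z * 'D_(axis (Some j)) phi z) <= h' z} ->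
  (\int[mu]_(z in Q) G z = 0)%R ->
  (\int[mu]_z A z <= \int[mu]_z (om z * 'D_(axis None) phi z * rho z.1) +
     \sum_j \int[mu]_z cross (Some j) z + \int[mu]_z h z)%R.
Proof.
move=> cross cK KQ iK ephi phiK mom om01 gaP mrho rhoC mdel delC iA ih ih' AhK AG G0.
have clK : closed K by apply: compact_closed => //; exact: norm_hausdorff.
have omb z : `|om z| <= 1 by have /andP[om_ge0 om_le1] := om01 z; rewrite ger0_norm.
have omi th : elem th -> (forall z, ~ K z -> th z = 0) ->
    mu.-integrable [set: _] (EFin \o (fun z => om z * th z)).
  move=> eth th0; have [C _ Cb] := elem_bounded eth.
  apply: (integrable_supp (C := C) iK).
  - by apply: measurable_funM => //; exact: elem_measurable.
  - by move=> z; rewrite normrM (le_trans _ (Cb z))// ler_piMl.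
  - by move=> z /th0 ->; rewrite mulr0.
have gai o th : elem th -> (forall z, ~ K z -> th z = 0) ->
    mu.-integrable [set: _] (EFin \o (fun z => ga o z * th z)).
  move=> eth th0; have [C _ Cb] := elem_bounded eth; have [mg g2 _] := gaP o.
  by apply: (integrable_L2_supp iK mg g2 _ Cb) => //; exact: elem_measurable.
have D0 o z : ~ K z -> 'D_(axis o) phi z = 0 by exact: derive_off.
have DD0 o z : ~ K z -> 'D_(axis o) ('D_(axis o) phi) z = 0.
  by apply: derive_off => // {}z; exact: D0.
have eD o : elem ('D_(axis o) phi) by exact: elem_derive.
have mrho' : measurable_fun [set: 'rV[R]_N * measurableTypeR R] (rho \o fst).
  exact: (measurableT_comp mrho measurable_fst).
have mdel' : measurable_fun [set: 'rV[R]_N * measurableTypeR R] (del \o snd).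
  exact: (measurableT_comp mdel measurable_snd).
have rhob (z : spacetime) : `|(rho \o fst) z| <= C1.
  by have /andP[r0 r1] := rhoC z.1; rewrite /= ger0_norm.
have delb (z : spacetime) : `|(del \o snd) z| <= C2.
  by have /andP[r0 r1] := delC z.2; rewrite /= ger0_norm.
have ti := integrableM_bounded mrho' rhob (gai None phi ephi phiK).
have xi j := integrableM_bounded mdel' delb (gai (Some j) _ (eD (Some j)) (D0 (Some j))).
(* [rho] depends on [x] alone, so it is an admissible multiplier for the time derivative. *)
have timeE : (\int[mu]_z (ga None z * phi z * rho z.1) =
    - \int[mu]_z (om z * 'D_(axis None) phi z * rho z.1))%R.
  have [_ _ wd] := gaP None.
  rewrite /Rintegral -fineN; congr fine.
  apply: (weak_deriv_multiplier (e := @Some _) measurable_fst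
    (@measurable_orthants_rV R N) _ _ _ cK KQ ephi phiK wd _ _ mrho rhoC) => //.
  - exact: measurable_coor.
  - exact: (omi _ (eD None) (D0 None)).
  - exact: (gai None phi ephi phiK).
(* Tested with the first derivative of [phi], so that both derivatives land on [phi] and only the
   bounded [om] remains; [del] depends on time alone. *)
have spaceE j : (\int[mu]_z (ga (Some j) z * 'D_(axis (Some j)) phi z * del z.2) =
    - \int[mu]_z cross (Some j) z)%R.
  have [_ _ wd] := gaP (Some j).
  rewrite /Rintegral -fineN; congr fine.
  apply: (weak_deriv_multiplier (e := fun _ : unit => None) measurable_snd
    (@measurable_orthants_R R) _ _ _ cK KQ (eD (Some j)) (D0 (Some j)) wd _ _ mdel delC) => //.
  - exact: (omi _ (elem_derive _ (eD (Some j))) (DD0 (Some j))).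
  - exact: (gai (Some j) _ (eD (Some j)) (D0 (Some j))).
pose base z := ga None z * phi z * rho z.1 +
  \sum_j ga (Some j) z * 'D_(axis (Some j)) phi z * del z.2.
have ibase : mu.-integrable [set: _] (EFin \o base).
  rewrite (_ : _ \o _ = (EFin \o (fun z => ga None z * phi z * rho z.1)) \+
     (EFin \o (fun z => \sum_j ga (Some j) z * 'D_(axis (Some j)) phi z * del z.2)));
    last by apply/funext.
  by apply: integrableD => //; exact: integrable_Rsum.
have baseE z : rho z.1 * ga None z * phi z +
    del z.2 * (\sum_j ga (Some j) z * 'D_(axis (Some j)) phi z) = base z.
  rewrite /base mulr_sumr; congr (_ + _); first by ring.
  by apply: eq_bigr => j _; rewrite mulrC.
have base0 z : ~ K z -> base z = 0.
  move=> Kz; rewrite /base phiK// mulr0 mul0r add0r big1// => j _.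
  by rewrite D0// mulr0 mul0r.
have iAh : mu.-integrable [set: _] (EFin \o (fun z => A z - h z)).
  rewrite (_ : _ \o _ = ((EFin \o A) \- (EFin \o h))%E); last by apply/funext.
  exact: integrableB.
have ilo : mu.-integrable [set: _] (EFin \o (fun z => base z + (A z - h z))).
  rewrite (_ : _ \o _ = (EFin \o base) \+ (EFin \o (fun z => A z - h z)));
    last by apply/funext.
  exact: integrableD.
have iup : mu.-integrable [set: _] (EFin \o (fun z => base z + h' z)).
  rewrite (_ : _ \o _ = (EFin \o base) \+ (EFin \o h')); last by apply/funext.
  exact: integrableD.
have nK z : ~ Q z -> ~ K z by move=> Qz /KQ.
have := Rintegral_sandwich0 ilo iup _ _ _ G0; rewrite RintegralD// RintegralB//.
rewrite RintegralD//; last exact: integrable_Rsum.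
rewrite timeE Rintegral_sum//.
under eq_bigr do rewrite spaceE.
rewrite sumrN => H; suff : - (\int[mu]_z (om z * 'D_(axis None) phi z * rho z.1))%R -
  \sum_j (\int[mu]_z cross (Some j) z)%R + ((\int[mu]_z A z)%R - (\int[mu]_z h z)%R) <= 0.
  by lra.
apply: H.
- by move=> z /nK Kz; rewrite base0//; have [-> -> _] := AhK _ Kz; rewrite subrr addr0.
- by move=> z /nK Kz; rewrite base0//; have [_ _ ->] := AhK _ Kz; rewrite addr0.
- apply: filterS AG => z H Qz; have := H Qz; rewrite baseE => /andP[H1 H2].
  by apply/andP; split; lra.
Qed.

End weak_form.

(** * A bound on the coupling term independent of the slab *)

Section slab_bounds.
Context {R : realType} {N : nat}.
Local Notation mu := (lebesgue_xt R N).
Local Notation leb := (lebesgue_rV R N).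

Lemma measurable_cylinder (Om : set 'rV[R]_N) (T : R) : open Om ->
  measurable (cylinder Om T : set ('rV[R]_N * measurableTypeR R)).
Proof.
move=> oOm; apply: measurableX; first exact: open_measurable_rV.
exact: measurable_itv.
Qed.

Lemma Rintegral_slab_le (f : 'rV[R]_N * R -> R) (F : 'rV[R]_N -> R) (s c : R) :
  0 <= c -> mu.-integrable [set: _] (EFin \o f) ->
  leb.-integrable [set: _] (EFin \o F) -> (forall x, 0 <= F x) ->
  (forall z, f z <= c * (F z.1 * \1_(`[s, s + 1]%classic) z.2)) ->
  (\int[mu]_z f z <= c * \int[leb]_x F x)%R.
Proof.
move=> c0 fi Fi F0 fF; have mF := measurable_int _ Fi; move/measurable_EFinP in mF.
have si := integrable_unit_slab s Fi F0.
apply: (@le_trans _ _ (\int[mu]_z (c * (F z.1 * \1_(`[s, s + 1]%classic) z.2)))%R).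
  by apply: le_Rintegral => //; exact: (integrableZl _ c si).
by rewrite RintegralZl// /Rintegral integral_unit_slab.
Qed.

Lemma integrable_mul_bump (u : 'rV[R]_N -> R) al be s :
  leb.-integrable [set: _] (EFin \o u) -> (forall x, 0 <= u x) ->
  mu.-integrable [set: _] (EFin \o (fun z => u z.1 * box_bump al be s z)).
Proof.
move=> ui u0; have [C C0 Cb] := @bump_bounds R N al be.
have mu' := measurable_int _ ui; move/measurable_EFinP in mu'.
apply: (@integrable_le_bound _ _ _ mu _
  (fun z : 'rV[R]_N * measurableTypeR R => C * (u z.1 * \1_(`[s, s + 1]%classic) z.2))).
- apply: measurable_funM; last by apply: elem_measurable; exact: elem_bump.
  exact: (measurableT_comp mu' measurable_fst).
- move=> z; have [zs|zs] := pselect (`[s, s + 1]%classic z.2).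
    rewrite indicE mem_set// mulr1 mulrC normrM (ger0_norm (u0 _)) ler_wpM2r//.
    by have [] := Cb s z.
  rewrite bump_off ?mulr0 ?normr0; last by case.
  by rewrite !mulr_ge0.
- exact: (integrableZl _ C (integrable_unit_slab s ui u0)).
Qed.

End slab_bounds.

(** Continuity is given on the closed half-line only, while a multiplier must be Borel on all of R;
    extending by zero achieves this. *)
Lemma measurable_patch_ge0 (R : realType) (dd : R -> R) : cont_diff_ge0 dd ->
  measurable_fun [set: measurableTypeR R] (dd \_ [set t | 0 <= t]).
Proof.
move=> [cd _].
have m0 : measurable ([set t | 0 <= t] : set (measurableTypeR R)).
  rewrite (_ : mkset _ = `[0, +oo[%classic); first exact: measurable_itv.
  by apply/seteqP; split=> t; rewrite /= in_itv/= andbT.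
apply/(measurable_restrictT _ m0).
exact: subspace_continuous_measurable_fun.
Qed.

Section coupling.
Context {R : realType} {N k : nat}.
Local Notation mu := (lebesgue_xt R N).
Local Notation leb := (lebesgue_rV R N).

(** [C] is fixed before [M] and [s], which forces the integral to decay like 1/M as the slab moves
    to late times. The versions [om] may depend on [s], being taken on the cylinder of height
    [s + 2]. *)
Lemma coupling_estimate (Omega : set 'rV[R]_N)
    (a : 'I_k -> 'I_k -> R -> 'rV[R]_N -> R)
    (f : 'I_k -> R -> 'rV[R]_N -> R -> R) (beta : R -> 'rV[R]_N -> R)
    (d : 'I_k -> R -> R) (r : 'I_k -> 'rV[R]_N -> R)
    (w : 'I_k -> 'rV[R]_N * R -> R) (mubar : R) (i j : 'I_k) al be :
  open Omega -> coefficient_hyp Omega a f beta d r 0 0 ->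
  0 < mubar ->
  (forall i j t x, 0 <= t -> Omega x -> i != j -> mubar <= a i j t x) ->
  weak_solution Omega a f beta d r w ->
  i != j -> cbox al be `<=` Omega ->
  exists C : R, forall M s, 0 <= M -> 1 <= s ->
    (forall t x, s <= t <= s + 1 -> Omega x -> M <= beta t x) ->
    exists om : 'I_k -> 'rV[R]_N * R -> R, [/\
      forall m, measurable_fun [set: 'rV[R]_N * measurableTypeR R] (om m),
      forall m z, 0 <= om m z <= 1,
      {ae mu, forall z, cylinder Omega (s + 2) z -> forall m, w m z = om m z},
      mu.-integrable [set: _]
        (EFin \o (fun z => om i z * om j z ^+ 2 * box_bump al be s z)) &
      M * (\int[mu]_z (om i z * om j z ^+ 2 * box_bump al be s z))%R <= C].
Proof.
move=> oOm [U1 [U2 [U3 [[wU1 wU2 wU3] [L13 L2] [hA hF] hB [hD hR]]]]] mb0 a_ge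
  [wH w01 weq] ij boxOm.
have mOm := open_measurable_rV oOm.
have [u2 [mu2 u2_0 u2i U2u2]] := in_L1_version mOm L2 (fun x Ox => ltW (wU2.2 x Ox)).
have U13_0 x : Omega x -> 0 <= U1 x * U3 x.
  by move=> Ox; rewrite mulr_ge0// ltW//; [exact: wU1.2|exact: wU3.2].
have [u13 [mu13 u13_0 u13i U13u13]] := in_L1_version mOm L13 U13_0.
have [lr [R1 [R2 [R1_0 R2_0 rR]]]] := hR.
have r_ae : {ae leb, forall x, Omega x -> 0 <= r i x <= R2}.
  apply/aeW => x Ox; have /andP[r1 r2] := rR i x Ox.
  by rewrite r2 (le_trans (ltW R1_0) r1).
have [rho [mrho rhoC rrho]] := bounded_version (ltW R2_0) mOm (lr i) r_ae.
have [d_0 d_cont [D1 [D3 [rh [[D1_0 _ _] _ _ dD]]]]] := hD.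
pose del := d i \_ [set t : R | 0 <= t].
have mdel : measurable_fun [set: measurableTypeR R] del.
  exact: measurable_patch_ge0.
have delE t : 0 <= t -> del t = d i t by move=> t0; rewrite /del patchE mem_set.
have delC t : 0 <= del t <= D1.
  rewrite /del patchE; case: ifPn => [/set_mem t0|_]; last by rewrite lexx ltW.
  have [_ d2 _] := dD i t t0; rewrite (ltW (d_0 i t t0))/=.
  by rewrite mul0r expR0 mulr1 in d2.
have [_ a0 a_sym _ [A1 [A2 [A1_0 A2_0 aA]]]] := hA.
have [_ _ _ _ [H1 [I [H1_0 _ _ I01 fH]]]] := hF.
have [_ beta_0 _ [B1 [B2 [B1_0 B2_0 betaB]]]] := hB.
have [Cb Cb0 CbP] := @bump_bounds R N al be.
pose Kx := cbox al be.
have iKx : leb.-integrable [set: _] (EFin \o (\1_Kx : _ -> R)).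
  apply/integrableP; split.
    by apply/measurable_EFinP/measurable_indic; exact: measurable_cbox.
  under eq_integral => x _ do rewrite /= ger0_norm//.
  by rewrite integral_indic ?setIT//; [exact: lebesgue_cbox_lty|exact: measurable_cbox].
have Kx0 x : 0 <= (\1_Kx x : R) by [].
pose L := (\int[leb]_x \1_Kx x)%R.
pose J2 := (\int[leb]_x u2 x)%R.
(* The summands bound the time-derivative, diffusion and reaction terms; the division by [mubar]
   comes from the lower bound on [a i j]. *)
exists ((Cb * R2 * L + \sum_(l < N) Cb * D1 * L + H1 * Cb * J2) / mubar).
move=> M s M0 s1 betaM.
(* With [s >= 1], the closed time interval [s, s + 1] lies inside ]0, T[, so the support of [phi] is
   compact in [Q]. *)
pose T := s + 2; pose Q := cylinder Omega T; pose phi := box_bump al be s.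
have T0 : 0 < T by rewrite /T; lra.
have mQ : measurable (Q : set ('rV[R]_N * measurableTypeR R)).
  exact: measurable_cylinder.
pose K : set ('rV[R]_N * R) := Kx `*` `[s, s + 1]%classic.
have cK : compact K.
  by apply: compact_setX; [exact: compact_cbox|exact: segment_compact].
have KQ : K `<=` Q.
  move=> z [z1 z2]; split; first exact: boxOm.
  move: z2; rewrite /= !in_itv/= => /andP[z3 z4]; apply/andP; split; first lra.
  by rewrite /T; lra.
have phiK z : ~ K z -> phi z = 0 by exact: bump_off.
have QP z : Q z -> [/\ Omega z.1, 0 <= z.2 & z.2 <= T].
  by move=> [z1]; rewrite /= in_itv/= => /andP[z2 z3]; split => //; exact: ltW.
have Kslab z : \1_K z = \1_Kx z.1 * \1_(`[s, s + 1]%classic) z.2 :> R.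
  rewrite !indicE -natrM mulnb; congr (_%:R); congr nat_of_bool.
  by apply/idP/andP; rewrite !inE.
have iK : mu.-integrable [set: _] (EFin \o (\1_K : _ -> R)).
  rewrite (_ : _ \o _ = EFin \o (fun z => \1_Kx z.1 * \1_(`[s, s + 1]%classic) z.2)).
    exact: integrable_unit_slab.
  by apply/funext => z; rewrite /= Kslab.
have w_ae m : {ae mu, forall z, Q z -> 0 <= w m z <= 1}.
  by apply: filterS (w01 m) => z H /QP[z1 z2 _]; exact: H.
have /choice[om omP] : forall m, exists g : 'rV[R]_N * R -> R, [/\
    measurable_fun [set: 'rV[R]_N * measurableTypeR R] g,
    forall z, 0 <= g z <= 1 & {ae mu, forall z, Q z -> w m z = g z}].
  by move=> m; have [[lw _] _] := wH T m T0; exact: (bounded_version ler01 mQ lw (w_ae m)).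
(* [weak_deriv] takes a junk value if no weak derivative exists; membership in H^1 provides one. *)
have wd o : in_L2 mu Q (weak_deriv Q (axis o) (w i)) /\
    is_weak_deriv Q (axis o) (w i) (weak_deriv Q (axis o) (w i)).
  have [_ /(_ o)[g g2 gd]] := wH T i T0.
  have ex : exists h, [set h | in_L2 mu Q h /\ is_weak_deriv Q (axis o) (w i) h] h.
    by exists g.
  exact: (xgetPex (fun=> 0) ex).
have /choice[ga gaP] : forall o, exists g : 'rV[R]_N * R -> R, [/\
    measurable_fun [set: 'rV[R]_N * measurableTypeR R] g,
    mu.-integrable [set: _] (EFin \o (fun z => g z ^+ 2)) &
    {ae mu, forall z, Q z -> weak_deriv Q (axis o) (w i) z = g z}].
  by move=> o; exact: (in_L2_version mQ (wd o).1).
have om_ae : {ae mu, forall z, Q z -> forall m, w m z = om m z}.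
  have : {ae mu, forall z, forall m, Q z -> w m z = om m z}.
    by apply: filter_forall => m; have [] := omP m.
  by apply: filterS => z H Qz m; exact: H.
have ga_ae : {ae mu, forall z, forall o, Q z -> weak_deriv Q (axis o) (w i) z = ga o z}.
  by apply: filter_forall => o; have [] := gaP o.
have momi : measurable_fun [set: 'rV[R]_N * measurableTypeR R] (om i) by have [] := omP i.
have momj : measurable_fun [set: 'rV[R]_N * measurableTypeR R] (om j) by have [] := omP j.
have omb m z : 0 <= om m z <= 1 by have [_ + _] := omP m; apply.
have ephi : elem phi by exact: elem_bump.
have mphi := elem_measurable ephi.
have phi0 z : 0 <= phi z by exact: bump_ge0.
have phiC z : phi z <= Cb by have [+ _ _] := CbP s z; rewrite ger0_norm.
pose A z := M * mubar * (om i z * om j z ^+ 2 * phi z).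
have iA1 : mu.-integrable [set: _] (EFin \o (fun z => om i z * om j z ^+ 2 * phi z)).
  apply: (integrable_supp (C := Cb) iK).
  - apply: measurable_funM => //; apply: measurable_funM => //.
    exact: measurable_funX.
  - move=> z; have /andP[p0 p1] := omb i z; have /andP[q0 q1] := omb j z.
    have q2 : om j z ^+ 2 <= 1 by rewrite expr_le1.
    have pq : om i z * om j z ^+ 2 <= 1 by rewrite mulr_ile1 ?sqr_ge0.
    rewrite ger0_norm; last by rewrite mulr_ge0// mulr_ge0// sqr_ge0.
    by apply: le_trans (phiC z); rewrite ler_piMl.
  - by move=> z /phiK ->; rewrite mulr0.
exists om; split => //; first by move=> m; have [] := omP m.
have iA : mu.-integrable [set: _] (EFin \o A) by exact: (integrableZl _ (M * mubar) iA1).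
(* [E] grows with [s], but it enters [h'] alone and thus not the constant of the estimate. *)
pose E := k%:R * (B1 * expR (B2 * T)) * (A1 * expR (A2 * T)).
have E0 : 0 <= E by rewrite !mulr_ge0 ?expR_ge0// ltW.
pose h z := H1 * (u2 z.1 * phi z).
pose h' z := H1 * (u2 z.1 * phi z) + E * (u13 z.1 * phi z).
have i2 := integrable_mul_bump al be s u2i u2_0.
have i13 := integrable_mul_bump al be s u13i u13_0.
have ih : mu.-integrable [set: _] (EFin \o h) by exact: (integrableZl _ H1 i2).
have ih' : mu.-integrable [set: _] (EFin \o h').
  rewrite (_ : _ \o _ = (EFin \o h) \+ (EFin \o (fun z => E * (u13 z.1 * phi z))));
    last by apply/funext.
  by apply: integrableD => //; exact: (integrableZl _ E i13).
have AhK z : ~ K z -> [/\ A z = 0, h z = 0 & h' z = 0].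
  by move=> /phiK pz; rewrite /A /h /h' pz !mulr0 addr0.
have gaP' o : [/\ measurable_fun [set: 'rV[R]_N * measurableTypeR R] (ga o),
    mu.-integrable [set: _] (EFin \o (fun z => ga o z ^+ 2)) &
    is_weak_deriv Q (axis o) (om i) (ga o)].
  have [mg g2 gg] := gaP o; split => //.
  apply: weak_deriv_version (wd o).2 => //.
  by apply: filterS om_ae => z H Qz; exact: H.
have tphi : test_fun Q phi.
  by split; [exact: elem_smooth|exists K; split].
have eq0 := (weq T i T0).1 phi tphi.
have pointwise : {ae mu, forall z, Q z -> A z - h z <=
    (r i z.1 * weak_deriv Q e_t (w i) z * phi z +
     d i z.2 * (\sum_(l < N) weak_deriv Q (e_x l) (w i) z * 'D_(e_x l) phi z) -
     zero_order a f beta w i z * phi z) -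
    (rho z.1 * ga None z * phi z +
       del z.2 * \sum_l ga (Some l) z * 'D_(axis (Some l)) phi z) <= h' z}.
  have w_all : {ae mu, forall z, forall m, Q z -> 0 <= w m z <= 1}.
    exact: filter_forall.
  have aeI := @filterI _ _ (ae_filter_lebesgue_xt R N).
  have fst_ae := aeI _ _ (ae_fst rrho) (aeI _ _ (ae_fst U2u2) (ae_fst U13u13)).
  have all_ae := aeI _ _ (aeI _ _ om_ae ga_ae) (aeI _ _ w_all fst_ae).
  apply: filterS all_ae => -[x t] /= [[omE gaE] [wb [rE [u2E u13E]]]] Qz.
  have [/= Ox t0 tT] := QP _ Qz.
  rewrite -(gaE None Qz) -(rE Ox) delE//.
  under [X in _ - (_ + _ * X)]eq_bigr => l _ do rewrite -(gaE (Some l) Qz).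
  rewrite /= [X in _ <= X <= _](_ : _ = - zero_order a f beta w i (x, t) * phi (x, t));
    last by ring.
  (* Both bounds vanish together with [phi]. Elsewhere the point lies in [K], so [t] is in
     [s, s + 1] and the bound [M <= beta t x] applies. *)
  have [pz|pz] := eqVneq (phi (x, t)) 0.
    by rewrite /A /h /h' pz !mulr0 subr0 addr0 lexx.
  have [Kx' Kt] : K (x, t) by apply: contrapT => /phiK /eqP; rewrite (negbTE pz).
  have {Kt} st : s <= t <= s + 1 by move: Kt; rewrite /= in_itv.
  rewrite /A /h /h' /= -(omE Qz i) -(omE Qz j) -(u2E Ox) -(u13E Ox).
  have /andP[wi0 wi1] := wb i Qz.
  have /andP[wj0 wj1] := wb j Qz.
  have Iw : I (w i (x, t)) by apply: I01; rewrite /= in_itv/= wi0.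
  have [fb _] := fH i t x _ t0 Ox Iw; rewrite mul0r expR0 mulr1 in fb.
  move: fb; rewrite ler_norml => /andP[f1 f2].
  rewrite /zero_order /=; set S := \sum_(m < k | m != i) _.
  (* Only the term [m = j] is kept; the others are nonnegative. *)
  have Slow : mubar * w j (x, t) ^+ 2 <= S.
    rewrite /S (bigD1 j) 1?eq_sym//= -[leLHS]addr0 lerD//.
      by rewrite ler_wpM2r ?sqr_ge0// a_ge.
    apply: sumr_ge0 => m /andP[mi _]; rewrite mulr_ge0 ?sqr_ge0//.
    by rewrite (le_trans (ltW mb0))// a_ge// eq_sym.
  have U1x := wU1.2 x Ox; have U3x := wU3.2 x Ox.
  have Sup : S <= k%:R * (A1 * expR (A2 * T) * U1 x).
    apply: (@le_trans _ _ (\sum_(m < k | m != i) A1 * expR (A2 * T) * U1 x)).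
      apply: ler_sum => m mi; have /andP[wm0 wm1] := wb m Qz.
      have am0 : 0 <= a i m t x by rewrite (le_trans (ltW mb0))// a_ge// eq_sym.
      apply: (@le_trans _ _ (a i m t x)); first by rewrite ler_piMr// expr_le1.
      have [am _] := aA i m t x t0 Ox; apply: le_trans am _.
      by rewrite ler_wpM2r ?(ltW U1x)// ler_wpM2l// ler_expR ler_wpM2l.
    rewrite mulr_natl -[X in _ *+ X]card_ord -sumr_const big_mkcond.
    apply: ler_sum => m _; case: ifP => // _.
    by rewrite !mulr_ge0 ?expR_ge0// ltW.
  have S0 : 0 <= S by rewrite (le_trans _ Slow)// mulr_ge0 ?sqr_ge0// ltW.
  have bt0 := beta_0 t x t0 Ox.
  have bM := betaM t x st Ox.
  have [bB _] := betaB t x t0 Ox.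
  have bB' : beta t x <= B1 * expR (B2 * T) * U3 x.
    apply: le_trans bB _; rewrite ler_wpM2r ?(ltW U3x)// ler_wpM2l ?(ltW B1_0)//.
    by rewrite ler_expR ler_wpM2l// ltW.
  have low : M * mubar * (w i (x, t) * w j (x, t) ^+ 2) <= beta t x * w i (x, t) * S.
    rewrite (_ : M * mubar * _ = M * w i (x, t) * (mubar * w j (x, t) ^+ 2)); last by ring.
    apply: ler_pM => //; [by rewrite mulr_ge0|by rewrite mulr_ge0 ?sqr_ge0// ltW|].
    by rewrite ler_wpM2r.
  have up : beta t x * w i (x, t) * S <= E * (U1 x * U3 x).
    rewrite (_ : E * _ = (B1 * expR (B2 * T) * U3 x) * (k%:R * (A1 * expR (A2 * T) * U1 x)));
      last by rewrite /E; ring.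
    apply: ler_pM => //; first by rewrite mulr_ge0// ltW.
    by apply: le_trans bB'; rewrite ler_piMr// ltW.
  have p0 := phi0 (x, t).
  apply/andP; split.
    rewrite (_ : _ - _ = (M * mubar * (w i (x, t) * w j (x, t) ^+ 2) - H1 * U2 x)
      * phi (x, t)); last by ring.
    by rewrite ler_wpM2r//; lra.
  rewrite (_ : _ + _ = (H1 * U2 x + E * (U1 x * U3 x)) * phi (x, t)); last by ring.
  by rewrite ler_wpM2r//; lra.
have := weak_form_estimate cK KQ iK ephi phiK momi (omb i) gaP' mrho rhoC mdel delC
  iA ih ih' AhK pointwise eq0.
rewrite /A RintegralZl// => est.
(* One bound serves both integrated terms: [th] is a derivative of [phi] and [q] is [rho] or [del].
   The support in [K] brings in [L], the volume of the box. *)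
have bound (th q : 'rV[R]_N * R -> R) (Cq : R) : elem th -> (forall z, `|th z| <= Cb) ->
    (forall z, ~ K z -> th z = 0) ->
    measurable_fun [set: 'rV[R]_N * measurableTypeR R] q ->
    (forall z, 0 <= q z <= Cq) ->
    (\int[mu]_z (om i z * th z * q z) <= Cb * Cq * L)%R.
  move=> eth thC th0 mq qC.
  have Cq0 : 0 <= Cq by have /andP[q0 q1] := qC (0, 0); exact: le_trans q1.
  have le1 z : `|om i z * th z * q z| <= Cb * Cq.
    have /andP[p0 p1] := omb i z; have /andP[q0 q1] := qC z.
    rewrite !normrM (ger0_norm p0) (ger0_norm q0) ler_pM ?mulr_ge0//.
    by rewrite -[leRHS]mul1r ler_pM.
  have off0 z : ~ K z -> om i z * th z * q z = 0.
    by move=> /th0 ->; rewrite mulr0 mul0r.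
  apply: (@Rintegral_slab_le _ _ _ _ s) => //; first exact: mulr_ge0.
    apply: (integrable_supp iK _ le1) => //.
    by apply: measurable_funM => //; apply: measurable_funM => //; exact: elem_measurable.
  move=> z; rewrite -Kslab; have [Kz|Kz] := pselect (K z).
    by rewrite indicE mem_set// mulr1 (le_trans (ler_norm _)).
  by rewrite off0// mulr_ge0// mulr_ge0.
have clK : closed K by apply: compact_closed => //; exact: norm_hausdorff.
have D0 o z : ~ K z -> 'D_(axis o) phi z = 0 by exact: derive_off.
rewrite ler_pdivlMr// mulrAC; apply: le_trans est _.
apply: lerD; [apply: lerD; [|apply: ler_sum => l _]|].
- apply: (bound ('D_(axis None) phi) (fun z => rho z.1)) => //.
  + exact: elem_derive.
  + by move=> z; have [_ + _] := CbP s z; apply.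
  + exact: D0.
  + exact: (measurableT_comp mrho measurable_fst).
- apply: (bound ('D_(axis (Some l)) ('D_(axis (Some l)) phi)) (fun z => del z.2)) => //.
  + exact/elem_derive/elem_derive.
  + by move=> z; have [_ _ +] := CbP s z; apply.
  + by move=> z; apply: derive_off => // {}z; exact: D0.
  + exact: (measurableT_comp mdel measurable_snd).
- apply: (@Rintegral_slab_le _ _ _ _ s) => //; first exact: mulr_ge0.
  move=> z; rewrite /h -mulrA ler_wpM2l//.
  have [zs|zs] := pselect (`[s, s + 1]%classic z.2).
    by rewrite indicE mem_set// mulr1 mulrC ler_wpM2r.
  rewrite phiK; last by case.
  by rewrite mulr0 !mulr_ge0.
Qed.

End coupling.

(** * Passage to the limit on a box *)

Section truncation.
Context {R : realType}.
Implicit Types x y : R.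

(** The absolute value, instead of a positive part, makes 0 the only zero. Segregation of the
    truncated limit then gives that of the limit itself, with no prior proof that the limit lies in
    [0, 1]. *)
Definition trunc1 x : R := Num.min 1 `|x|.

Lemma trunc1_ge0_le1 x : 0 <= trunc1 x <= 1.
Proof. by rewrite /trunc1 le_min ler01 normr_ge0 ge_min lexx. Qed.

Lemma trunc1_eq0 x : trunc1 x = 0 -> x = 0.
Proof.
rewrite /trunc1 minEle; case: ifP => [_ /eqP|_ /eqP]; first by rewrite oner_eq0.
by rewrite normr_eq0 => /eqP.
Qed.

Lemma trunc1_dist x y : 0 <= x <= 1 -> `|x - trunc1 y| <= `|x - y|.
Proof.
move=> /andP[x0 x1]; rewrite /trunc1 minEle; case: ifPn => [y1|].
  rewrite ler0_norm ?subr_le0//; have [y0|y0] := leP 0 y.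
    by move: y1; rewrite ger0_norm// => y1; rewrite ler0_norm; lra.
  by move: y1; rewrite ltr0_norm// => y1; rewrite ger0_norm; lra.
rewrite -ltNge => y1; have [y0|y0] := leP 0 y; first by rewrite (ger0_norm y0).
rewrite (ltr0_norm y0) opprK (@ger0_norm _ (x - y)); last by lra.
by rewrite ler_norml; apply/andP; split; lra.
Qed.

Lemma measurable_trunc1 : measurable_fun [set: R] trunc1.
Proof. by apply: measurable_minr => //; exact: normr_measurable. Qed.

(** From p q^2 - x y^2 = (p - x) q^2 + x (q + y) (q - y), whose coefficients are at most 1 and 2 on
    the unit interval. *)
Lemma coupling_stability (p q x y : R) : 0 <= p <= 1 -> 0 <= q <= 1 ->
  0 <= x <= 1 -> 0 <= y <= 1 ->
  p * q ^+ 2 <= x * y ^+ 2 + (`|x - p| + 2 * `|y - q|).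
Proof.
move=> /andP[p0 p1] /andP[q0 q1] /andP[x0 x1] /andP[y0 y1].
have h1 : p - x <= `|x - p| by rewrite distrC ler_norm.
have h2 : q - y <= `|y - q| by rewrite distrC ler_norm.
have n1 := normr_ge0 (x - p); have n2 := normr_ge0 (y - q).
have -> : p * q ^+ 2 = x * y ^+ 2 + ((p - x) * q ^+ 2 + x * (q + y) * (q - y)) by ring.
rewrite lerD2l; apply: lerD.
  apply: (@le_trans _ _ (`|x - p| * q ^+ 2)); first by rewrite ler_wpM2r ?sqr_ge0.
  by rewrite ler_piMr// expr_le1.
have xq0 : 0 <= x * (q + y) by rewrite mulr_ge0// addr_ge0.
apply: (@le_trans _ _ (x * (q + y) * `|y - q|)); first by rewrite ler_wpM2l.
by rewrite ler_wpM2r//; nra.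
Qed.

End truncation.

Lemma ae_countable_cover d (T : measurableType d) (R : realType)
    (mu : {measure set T -> \bar R}) (I : countType) (B : I -> set T) (P : T -> Prop) :
  (forall i, {ae mu, forall x, B i x -> P x}) ->
  {ae mu, forall x, (exists i, B i x) -> P x}.
Proof.
move=> H.
apply: (@negligibleS _ _ _ _ (\bigcup_n
  (if unpickle n is Some i then ~` [set x | B i x -> P x] else set0))).
  move=> x /= /not_implyP[[i Bx] Px]; exists (pickle i) => //=.
  by rewrite pickleK /= => /(_ Bx).
apply: negligible_bigcup => n; case: unpickle => [i|]; first exact: H.
exact: negligible_set0.
Qed.

#[global] Instance ae_filter_lebesgue_measure (R : realType) :
  Filter (nbhs (almost_everywhere (@lebesgue_measure R))).
Proof. exact: (ae_filter_ringOfSetsType (@lebesgue_measure R)). Qed.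

Section segregation_box.
Context {R : realType} {N k : nat}.
Local Notation mu := (lebesgue_xt R N).
Local Notation leb := (lebesgue_rV R N).

(** The slab has length 1, so by Tonelli a bound [e] at almost every time integrates to [e]. *)
Lemma slab_distance_le (om : 'rV[R]_N * R -> R) (p : 'rV[R]_N -> R)
    (K : set 'rV[R]_N) (s e : R) : 0 <= e ->
  measurable_fun [set: 'rV[R]_N * measurableTypeR R] om ->
  measurable_fun [set: _] p -> measurable K ->
  {ae @lebesgue_measure R, forall t, s <= t <= s + 1 ->
    (\int[leb]_(x in K) `|om (x, t) - p x|%:E <= e%:E)%E} ->
  (\int[mu]_z (`|om z - p z.1| * \1_K z.1 * \1_(`[s, s + 1]%classic) z.2)%:E <= e%:E)%E.
Proof.
move=> e0 mom mp mK ae_t.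
have mF : measurable_fun [set: 'rV[R]_N * measurableTypeR R]
    (fun z => (`|om z - p z.1| * \1_K z.1 * \1_(`[s, s + 1]%classic) z.2)%:E : \bar R).
  apply/measurable_EFinP; apply: measurable_funM.
    apply: measurable_funM.
      apply: measurableT_comp => //; apply: measurable_funB => //.
      exact: (measurableT_comp mp measurable_fst).
    by apply: (measurableT_comp _ measurable_fst); exact: measurable_indic.
  by apply: (measurableT_comp _ measurable_snd); exact: measurable_indic.
have F0 z : (0 <= (`|om z - p z.1| * \1_K z.1 * \1_(`[s, s + 1]%classic) z.2)%:E :> \bar R)%E.
  by rewrite lee_fin !mulr_ge0.
have := fubini_tonelli1 (m1 := leb) (m2 := @lebesgue_measure R) _ mF F0.
have := fubini_tonelli (m1 := leb) (m2 := @lebesgue_measure R) _ mF F0.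
rewrite /fubini_F /fubini_G => -> -> /=.
apply: (@le_trans _ _ (\int[@lebesgue_measure R]_t (e%:E * (\1_(`[s, s + 1]%classic) t)%:E))%E).
  apply: ae_le_lower_integral; apply: filterS ae_t => t Ht _.
  have [st|st] := boolP (t \in `[s, s + 1]%classic); last first.
    rewrite indicE (negbTE st) mule0 (_ : (fun x => _) = fun=> 0%E) ?integral0//.
    by apply/funext => x; rewrite mulr0.
  rewrite indicE st mule1; apply: le_trans (Ht _); last first.
    by move: st; rewrite inE/= in_itv.
  rewrite [leRHS]integral_mkcond; apply: ae_le_lower_integral; apply/aeW => x _.
  by rewrite patchE mulr1 indicE; case: ifP => _; rewrite ?mulr1 ?mulr0.
have len1 : @lebesgue_measure R `[s, s + 1]%classic = 1%E.
  by rewrite lebesgue_measure_itv/= lte_fin ltrDl ltr01 -EFinD addrC addKr.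
rewrite ge0_integralZl//.
- by rewrite integral_indic// setIT [X in (_ * X)%E](_ : _ = 1%E) ?mule1.
- by apply/measurable_EFinP; exact: measurable_indic.
Qed.

(** The constant is the lower bound of [bump_ge] times 1/2, the length of the middle half of the
    slab. *)
Lemma bump_integral_lower (F : 'rV[R]_N -> R) al be s : measurable_fun [set: _] F ->
  (forall x, 0 <= F x) ->
  (\int[leb]_x (F x * space_bump al be x)%:E * ((flat 1 4^-1) ^+ 2 / 2)%:E <=
   \int[mu]_z (F z.1 * box_bump al be s z)%:E)%E.
Proof.
move=> mF F0; pose c := flat 1 (4^-1 : R) ^+ 2.
have c0 : 0 <= c by exact: sqr_ge0.
pose J := `[s + 4^-1, s + 3 / 4]%classic.
have mFs : measurable_fun [set: _] (fun x => F x * space_bump al be x).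
  by apply: measurable_funM => //; exact: measurable_space_bump.
have lenJ : @lebesgue_measure R J = (2^-1)%:E.
  rewrite lebesgue_measure_itv/= lte_fin ifT; last by lra.
  by rewrite -EFinD; congr EFin; lra.
apply: (@le_trans _ _ (\int[mu]_z ((F z.1 * space_bump al be z.1 * c)%:E * (\1_J z.2)%:E))%E).
  rewrite (integral_fst_slab (F := fun x => (F x * space_bump al be x * c)%:E)).
  - under [X in (_ <= X * _)%E]eq_integral => x _ do rewrite EFinM.
    rewrite ge0_integralZr//.
    + by rewrite -muleA [X in (_ <= _ * (_ * X))%E]lenJ -EFinM.
    + exact/measurable_EFinP.
    + by move=> x _; rewrite lee_fin mulr_ge0// space_bump_ge0.
  - by apply/measurable_EFinP; exact: measurable_funM.
  - by move=> x; rewrite lee_fin mulr_ge0// mulr_ge0// space_bump_ge0.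
  - exact: measurable_itv.
apply: ae_le_lower_integral; apply/aeW => z _; rewrite -EFinM lee_fin.
have [zJ|zJ] := pselect (J z.2); last first.
  by rewrite indicE memNset// mulr0 mulr_ge0// bump_ge0.
rewrite indicE mem_set// mulr1 -mulrA ler_wpM2l//.
exact: bump_ge.
Qed.

(** Instead of a limit of integrals, one late slab is chosen for each [e], and a fixed multiple of
    the integral [Y] of p_i p_j^2 against [space_bump] is bounded by a constant times [e]. Hence [Y]
    vanishes, and so does p_i p_j^2 a.e. where the bump is positive. *)
Lemma segregation_box (Omega : set 'rV[R]_N)
    (a : 'I_k -> 'I_k -> R -> 'rV[R]_N -> R)
    (f : 'I_k -> R -> 'rV[R]_N -> R -> R) (beta : R -> 'rV[R]_N -> R)
    (d : 'I_k -> R -> R) (r : 'I_k -> 'rV[R]_N -> R) (b : R -> R) (mubar : R)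
    (w : 'I_k -> 'rV[R]_N * R -> R) (W : R -> 'I_k -> 'rV[R]_N -> R)
    (v : 'I_k -> 'rV[R]_N -> R) (i j : 'I_k) al be :
  open Omega -> coefficient_hyp Omega a f beta d r 0 0 ->
  (forall t x, 0 <= t -> Omega x -> b t <= beta t x) ->
  b t @[t --> +oo%R] --> +oo%R ->
  0 < mubar ->
  (forall i j t x, 0 <= t -> Omega x -> i != j -> mubar <= a i j t x) ->
  weak_solution Omega a f beta d r w -> continuous_repr Omega w W ->
  (forall i, in_L1loc Omega (v i)) -> cvg_L1loc Omega W v ->
  i != j -> cbox al be `<=` Omega ->
  {ae leb, forall x, obox al be x -> v i x * v j x = 0}.
Proof.
move=> oOm hcoef b_beta b_oo mb0 a_ge hw [_ _ hW] hv hlim ij boxOm.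
pose K := cbox al be.
have cK : compact K by exact: compact_cbox.
have mK : measurable K by exact: measurable_cbox.
have [C0 estC0] := coupling_estimate oOm hcoef mb0 a_ge hw ij boxOm.
(* The maximum with 1 makes [C / e] positive, hence an admissible value of [M]. *)
pose C := Num.max 1 C0.
have C_gt0 : 0 < C by rewrite lt_max ltr01.
have /choice[g gP] : forall m, exists g : 'rV[R]_N -> R,
    measurable_fun [set: _] g /\ {ae leb, forall x, K x -> v m x = g x}.
  move=> m; have [lv _] := hv m K cK boxOm.
  by have [g [mg _ _ vg]] := lmeasurable_version mK lv; exists g.
pose p m x := trunc1 (g m x).
have p01 m x : 0 <= p m x <= 1 by exact: trunc1_ge0_le1.
have mp m : measurable_fun [set: _] (p m).
  by apply: (measurableT_comp measurable_trunc1); have [] := gP m.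
pose F x := p i x * p j x ^+ 2.
have F0 x : 0 <= F x.
  by have /andP[p0 _] := p01 i x; rewrite mulr_ge0 ?sqr_ge0.
have mF : measurable_fun [set: _] F.
  by apply: measurable_funM => //; exact: measurable_funX.
have [Cb Cb0 CbP] := @bump_bounds R N al be.
pose Y := (\int[leb]_x (F x * space_bump al be x)%:E)%E.
pose c := (flat 1 (4^-1 : R)) ^+ 2 / 2.
have c0 : 0 < c by rewrite divr_gt0// exprn_gt0// flat1_gt0 invr_gt0.
have near_v m (e : R) : 0 < e -> exists s0 : R, forall t, s0 < t ->
    (\int[leb]_(x in K) `|W t m x - v m x|%:E < e%:E)%E.
  move=> e0; have := hlim m K cK boxOm [set y | (y < e%:E)%E].
  case; first by apply: open_nbhs_nbhs; split; [exact: open_ereal_lt_ereal|rewrite /= lte_fin].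
  by move=> s0 [_ Hs0]; exists s0.
(* The 1 accounts for the coupling integral, at most [e] once [beta >= C / e] on the slab; the 3 is
   the sum of the weights 1 and 2 in [coupling_stability]. *)
have small (e : R) : 0 < e -> (Y * c%:E <= ((1 + Cb * 3) * e)%:E)%E.
  move=> e0.
  have [si siP] := near_v i e e0; have [sj sjP] := near_v j e e0.
  have [sb [_ sbP]] := (cvgryPge b).1 b_oo (C / e).
  (* Adding 1 to each threshold makes [s] exceed it strictly, as the eventual statements at infinity
     require. *)
  pose s := Num.max 1 (Num.max (si + 1) (Num.max (sj + 1) (sb + 1))).
  have s1 : 1 <= s by rewrite le_max lexx.
  have ssi : si < s by rewrite !lt_max ltrDl ltr01 orbT.
  have ssj : sj < s by rewrite !lt_max ltrDl ltr01 !orbT.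
  have ssb : sb < s by rewrite !lt_max !ltrDl ltr01 !orbT.
  have beta_ge t x : s <= t <= s + 1 -> Omega x -> C / e <= beta t x.
    move=> /andP[st _] Ox; apply: le_trans (b_beta _ _ _ Ox); last by lra.
    by apply: sbP; exact: lt_le_trans st.
  have Ce0 : 0 < C / e by rewrite divr_gt0.
  have [om [mom om01 w_om iA estA]] := estC0 _ _ (ltW Ce0) s1 beta_ge.
  have {estA} estA : (\int[mu]_z (om i z * om j z ^+ 2 * box_bump al be s z)%:E <= e%:E)%E.
    rewrite -(fineK (integrable_fin_num measurableT iA)) lee_fin.
    rewrite -(ler_pM2l Ce0) divfK ?gt_eqF//; apply: le_trans estA _.
    by rewrite le_max lexx orbT.
  (* For almost every [t] the section of [om m] equals [W t m] a.e., both being versions of [w m];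
     [trunc1_dist] then replaces the limit by its truncation. *)
  have close m : (forall t, s <= t -> (\int[leb]_(x in K) `|W t m x - v m x|%:E < e%:E)%E) ->
      (\int[mu]_z (`|om m z - p m z.1| * \1_K z.1 * \1_(`[s, s + 1]%classic) z.2)%:E
        <= e%:E)%E.
    move=> Wv; apply: slab_distance_le => //; first exact: ltW.
    apply: filterS2 (hW m) (ae_ysection w_om) => t HW Hom st.
    have /andP[st1 st2] := st.
    apply: le_trans (ltW (Wv t st1)); apply: ae_le_lower_integral.
    have t0 : 0 < t by lra.
    apply: filterS3 (HW t0) Hom (gP m).2 => x Wx omx vx Kx.
    have Ox := boxOm _ Kx.
    have cyl : cylinder Omega (s + 2) (x, t).
      by split => //=; rewrite in_itv/=; apply/andP; split; lra.
    rewrite lee_fin (Wx Ox) (omx cyl m) (vx Kx); exact: trunc1_dist.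
  have Di := close i (fun t st => siP t (lt_le_trans ssi st)).
  have Dj := close j (fun t st => sjP t (lt_le_trans ssj st)).
  apply: le_trans (bump_integral_lower al be s mF F0) _.
  pose D m (z : 'rV[R]_N * measurableTypeR R) :=
    `|om m z - p m z.1| * \1_K z.1 * \1_(`[s, s + 1]%classic) z.2.
  have mD m : measurable_fun [set: 'rV[R]_N * measurableTypeR R] (D m).
    apply: measurable_funM.
      apply: measurable_funM.
        apply: measurableT_comp => //; apply: measurable_funB => //.
        exact: (measurableT_comp (mp m) measurable_fst).
      by apply: (measurableT_comp _ measurable_fst); exact: measurable_indic.
    by apply: (measurableT_comp _ measurable_snd); exact: measurable_indic.
  have D0 m z : 0 <= D m z by rewrite !mulr_ge0.
  have A0 z : 0 <= om i z * om j z ^+ 2 * box_bump al be s z.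
    have /andP[om_ge0 _] := om01 i z.
    by rewrite mulr_ge0 ?bump_ge0// mulr_ge0// sqr_ge0.
  have mA := measurable_int _ iA.
  apply: (@le_trans _ _ (\int[mu]_z ((om i z * om j z ^+ 2 * box_bump al be s z)%:E +
      Cb%:E * ((D i z)%:E + 2%:E * (D j z)%:E)))%E).
    apply: ae_le_lower_integral; apply/aeW => z _.
    rewrite -EFinM -EFinD lee_fin.
    have [Kz|Kz] := pselect ((K `*` `[s, s + 1]%classic) z); last first.
      by rewrite bump_off// !mulr0 add0r mulr_ge0// addr_ge0// mulr_ge0.
    have DE m : D m z = `|om m z - p m z.1|.
      by case: Kz => Kz1 Kz2; rewrite /D !indicE !mem_set// !mulr1.
    rewrite !DE; have bz : box_bump al be s z <= Cb.
      by have [+ _ _] := CbP s z; rewrite ger0_norm// bump_ge0.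
    have stab := coupling_stability (p01 i z.1) (p01 j z.1) (om01 i z) (om01 j z).
    apply: (@le_trans _ _ ((om i z * om j z ^+ 2 + (`|om i z - p i z.1| +
       2 * `|om j z - p j z.1|)) * box_bump al be s z)).
      by rewrite ler_wpM2r ?bump_ge0.
    by rewrite mulrDl lerD2l [leRHS]mulrC ler_wpM2l// addr_ge0// mulr_ge0.
  have mDj : measurable_fun [set: 'rV[R]_N * measurableTypeR R]
      (fun z => 2%:E * (D j z)%:E : \bar R)%E.
    by apply: emeasurable_funM => //; exact/measurable_EFinP.
  have mDij : measurable_fun [set: 'rV[R]_N * measurableTypeR R]
      (fun z => (D i z)%:E + 2%:E * (D j z)%:E : \bar R)%E.
    by apply: emeasurable_funD => //; exact/measurable_EFinP.
  have Dij0 z : (0 <= (D i z)%:E + 2%:E * (D j z)%:E)%E.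
    by rewrite adde_ge0 ?mule_ge0 ?lee_fin.
  rewrite ge0_integralD//; last 3 first.
  - by move=> z _; rewrite lee_fin.
  - by move=> z _; rewrite mule_ge0// lee_fin.
  - exact: emeasurable_funM.
  rewrite ge0_integralZl// ge0_integralD//; last 3 first.
  - by move=> z _; rewrite lee_fin.
  - exact/measurable_EFinP.
  - by move=> z _; rewrite mule_ge0// lee_fin.
  rewrite ge0_integralZl//; last 2 first.
  - exact/measurable_EFinP.
  - by move=> z _; rewrite lee_fin.
  rewrite [leRHS](_ : _ = e%:E + Cb%:E * (e%:E + 2%:E * e%:E))%E; last first.
    rewrite -EFinM -EFinD; congr EFin; ring.
  rewrite leeD// lee_wpmul2l ?lee_fin// leeD//.
  by rewrite lee_wpmul2l ?lee_fin.
have sb0 x : 0 <= F x * space_bump al be x by rewrite mulr_ge0// space_bump_ge0.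
have Y0 : (0 <= Y)%E by apply: integral_ge0 => x _; rewrite lee_fin.
have Yc : (Y * c%:E <= 0)%E.
  apply/lee_addgt0Pr => e e0; rewrite add0e.
  have C3 : 0 < 1 + Cb * 3 by rewrite ltr_pwDl// mulr_ge0.
  have := small (e / (1 + Cb * 3)) (divr_gt0 e0 C3).
  by rewrite mulrC divfK// gt_eqF.
have {}Y0 : Y = 0%E.
  apply/eqP; rewrite eq_le Y0 andbT leNgt; apply/negP => Ygt0.
  by move: Yc; rewrite leNgt mule_gt0// lte_fin.
have mFs : measurable_fun [set: 'rV[R]_N] (fun x => (F x * space_bump al be x)%:E : \bar R).
  apply/measurable_EFinP; apply: measurable_funM => //.
  exact: measurable_space_bump.
have Yabs : (\int[leb]_x `|(F x * space_bump al be x)%:E| = 0)%E.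
  by rewrite -[RHS]Y0; apply: eq_integral => x _; rewrite gee0_abs// lee_fin.
have Fs0 := (ae_eq_integral_abs leb measurableT mFs).1 Yabs.
apply: filterS3 Fs0 (gP i).2 (gP j).2 => x Fx vi vj Bx.
have Kx : K x.
  by move=> l; have := Bx l; rewrite /= !in_itv/= => /andP[/ltW -> /ltW ->].
rewrite (vi Kx) (vj Kx).
have /= [] := Fx I => /eqP; rewrite mulf_eq0 (gt_eqF (space_bump_gt0 Bx)) orbF.
rewrite /F mulf_eq0 expf_eq0/= => /orP[/eqP/trunc1_eq0 ->|/eqP/trunc1_eq0 ->].
  by rewrite mul0r.
by rewrite mulr0.
Qed.

End segregation_box.

(** * From boxes to the whole domain *)

Unset Implicit Arguments.
Set Strict Implicit.

Theorem theorem2p2 (R : realType) (N k : nat) (Omega : set 'rV[R]_N)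
    (a : 'I_k -> 'I_k -> R -> 'rV[R]_N -> R)
    (f : 'I_k -> R -> 'rV[R]_N -> R -> R)
    (beta : R -> 'rV[R]_N -> R)
    (d : 'I_k -> R -> R)
    (r : 'I_k -> 'rV[R]_N -> R)
    (hN : (0 < N)%N) (hk : (2 <= k)%N)
    (hOmega : bounded_smooth_domain Omega)
    (hcoef : coefficient_hyp Omega a f beta d r 0 0)
    (b : R -> R)
    (b_gt0 : forall t, 0 <= t -> 0 < b t)
    (b_le_beta : forall t x, 0 <= t -> Omega x -> b t <= beta t x)
    (b_oo : b t @[t --> +oo%R] --> +oo%R)
    (mubar : R) (mubar_gt0 : 0 < mubar)
    (a_ge : forall i j t x, 0 <= t -> Omega x -> i != j -> mubar <= a i j t x)
    (w : 'I_k -> 'rV[R]_N * R -> R)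
    (hw : weak_solution Omega a f beta d r w)
    (W : R -> 'I_k -> 'rV[R]_N -> R)
    (hW : continuous_repr Omega w W)
    (vbar : 'I_k -> 'rV[R]_N -> R)
    (hvbar : forall i, in_L1loc Omega (vbar i))
    (hlim : cvg_L1loc Omega W vbar) :
  segregated Omega vbar.
Proof.
have [_ oOmega _ _ _] := hOmega.
move=> i j ij.
(* Grid boxes that leave [Omega] are replaced by the empty set, so the countable family is indexed
   by all of [nk] and still covers [Omega]. *)
pose B (nk : nat * 'rV[int]_N) : set 'rV[R]_N :=
  if `[< cbox (grid_lo nk) (grid_hi nk) `<=` Omega >]
  then obox (grid_lo nk) (grid_hi nk) else set0.
have cover : {ae lebesgue_rV R N, forall x, (exists nk, B nk x) ->
    vbar i x * vbar j x = 0}.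
  apply: ae_countable_cover => nk; rewrite /B; case: ifP => [/asboolP sub|_].
    exact: (segregation_box oOmega hcoef b_le_beta b_oo mubar_gt0 a_ge hw hW
      hvbar hlim ij sub).
  exact/aeW.
apply: filterS cover => x + Omx; apply.
have [nk [sub xnk]] := open_grid oOmega Omx.
by exists nk; rewrite /B ifT//; apply/asboolP.
Qed.
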